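(* Let $f=(f_1,f_2):\mathbb{R}^2\times\mathbb{R}^2\to\mathbb{R}^2$ be continuously differentiable with variables $(x,y_1,y_2)$, $x\in\mathbb{R}^2$, and let $(a,b)$, $b=(b_1,b_2)$, satisfy $f(a,b)=(0,0)$ and $\det J_{f,y}(a,b)\ne0$, where $J_{f,y}=(\partial_{y_j}f_i)_{i,j}$. Then there exist a closed rectangle $R\subset\mathbb{R}^2$ containing $a$, closed intervals $V_1\ni b_1$, $V_2\ni b_2$ (put $V=V_1\times V_2$), indices $j\ne j'$ in $\{1,2\}$, and functions $p:R\times V_{j'}\to V_j$ and $q:R\to V_{j'}$ such that for all $x\in R$, $f(x,y)=(0,0)$ where $y_{j'}=q(x)$ and $y_j=p(x,q(x))$; moreover $p$ and $q$ are the limits, in the $\Gamma$-Cesàro sense, of their dyadic block-moment polynomial approximants $p_n=P_n(p)$ and $q_m=P_m(q)$ as $n,m\to\infty$.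
   Context: Rectangles/boxes are parallel to coordinate axes. For a closed box $Q=\prod_{k=1}^d[l_k,l_k+s_k]\subset\mathbb{R}^d$ and $n\ge0$, $\Gamma_n$ is the dyadic partition of $Q$ into the $2^{nd}$ boxes $\prod_k[l_k+(i_k-1)s_k2^{-n},\,l_k+i_ks_k2^{-n}]$, $1\le i_k\le 2^n$. For a continuous $h:Q\to\mathbb{R}$ and a base point $c\in Q$, $P_n(h)$ denotes the unique polynomial of degree at most $2^n-1$ in each variable $(z_k-c_k)$ such that $\int_B P_n(h)=\int_B h$ for every $B\in\Gamma_n$ (uniqueness follows from the invertibility of the matrices $\big(\int_{I_i}(t-c_k)^{j-1}dt\big)_{i,j}$ over the dyadic subintervals $I_i$). A sequence of integrable functions $h_n$ converges to $h$ in the $\Gamma$-Cesàro sense if for every $z\in Q$ and $\epsilon>0$ there is $N$ such that for all $n\ge N$ and every $B\in\Gamma_n$ containing $z$, $\left|\frac{1}{|B|}\int_B h_n-h(z)\right|<\epsilon$. Here $p$ is considered on the box $R\times V_{j'}\subset\mathbb{R}^3$ with base point $(a,b_{j'})$ and $q$ on $R$ with base point $a$. *)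

(* Defs.v *)
From Stdlib Require Import Reals.
From Coquelicot Require Import Coquelicot.
Open Scope R_scope.

Definition dx1 (g : R*R -> R*R -> R) (x y : R*R) : R :=
  Derive (fun t => g (t, snd x) y) (fst x).
Definition dx2 (g : R*R -> R*R -> R) (x y : R*R) : R :=
  Derive (fun t => g (fst x, t) y) (snd x).
Definition dy1 (g : R*R -> R*R -> R) (x y : R*R) : R :=
  Derive (fun t => g x (t, snd y)) (fst y).
Definition dy2 (g : R*R -> R*R -> R) (x y : R*R) : R :=
  Derive (fun t => g x (fst y, t)) (snd y).

Definition C1_comp (g : R*R -> R*R -> R) : Prop :=
  (forall x y : R*R,
     ex_derive (fun t => g (t, snd x) y) (fst x) /\
     ex_derive (fun t => g (fst x, t) y) (snd x) /\
     ex_derive (fun t => g x (t, snd y)) (fst y) /\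
     ex_derive (fun t => g x (fst y, t)) (snd y)) /\
  (forall w : (R*R)*(R*R),
     continuous (fun z : (R*R)*(R*R) => dx1 g (fst z) (snd z)) w /\
     continuous (fun z : (R*R)*(R*R) => dx2 g (fst z) (snd z)) w /\
     continuous (fun z : (R*R)*(R*R) => dy1 g (fst z) (snd z)) w /\
     continuous (fun z : (R*R)*(R*R) => dy2 g (fst z) (snd z)) w).

Definition f1 (f : R*R -> R*R -> R*R) : R*R -> R*R -> R := fun x y => fst (f x y).
Definition f2 (f : R*R -> R*R -> R*R) : R*R -> R*R -> R := fun x y => snd (f x y).

Definition cont_diff (f : R*R -> R*R -> R*R) : Prop := C1_comp (f1 f) /\ C1_comp (f2 f).

Definition jac_y_det (f : R*R -> R*R -> R*R) (x y : R*R) : R :=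
  dy1 (f1 f) x y * dy2 (f2 f) x y - dy2 (f1 f) x y * dy1 (f2 f) x y.

Definition in_cint (l s t : R) : Prop := l <= t <= l + s.

(* dyadic subinterval number i (0-based, i < 2^n) of [l, l+s]:
   [l + i s 2^-n, l + (i+1) s 2^-n] *)
Definition dlo (l s : R) (n i : nat) : R := l + INR i * s / 2 ^ n.
Definition dhi (l s : R) (n i : nat) : R := l + INR (S i) * s / 2 ^ n.

(* Integral over a 2-dim box [a1,b1]x[a2,b2] and a 3-dim box
   [a1,b1]x[a2,b2]x[a3,b3] (iterated Riemann integrals; all integrands below
   are continuous on the boxes). *)
Definition int2 (h : R*R -> R) (a1 b1 a2 b2 : R) : R :=
  RInt (fun u => RInt (fun v => h (u, v)) a2 b2) a1 b1.
Definition int3 (h : R*R -> R -> R) (a1 b1 a2 b2 a3 b3 : R) : R :=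
  RInt (fun u => RInt (fun v => RInt (fun w => h (u, v) w) a3 b3) a2 b2) a1 b1.

Definition poly2 (n : nat) (c : R*R) (P : R*R -> R) : Prop :=
  exists coef : nat -> nat -> R, forall z : R*R,
    P z = sum_f_R0 (fun i1 => sum_f_R0 (fun i2 =>
            coef i1 i2 * (fst z - fst c) ^ i1 * (snd z - snd c) ^ i2)
          (2 ^ n - 1)%nat) (2 ^ n - 1)%nat.

Definition poly3 (n : nat) (c : R*R) (c3 : R) (P : R*R -> R -> R) : Prop :=
  exists coef : nat -> nat -> nat -> R, forall (z : R*R) (z3 : R),
    P z z3 = sum_f_R0 (fun i1 => sum_f_R0 (fun i2 => sum_f_R0 (fun i3 =>
            coef i1 i2 i3 * (fst z - fst c) ^ i1 * (snd z - snd c) ^ i2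
              * (z3 - c3) ^ i3)
          (2 ^ n - 1)%nat) (2 ^ n - 1)%nat) (2 ^ n - 1)%nat.

Definition is_Pn2 (l s c : R*R) (n : nat) (h P : R*R -> R) : Prop :=
  poly2 n c P /\
  forall i1 i2 : nat, (i1 < 2 ^ n)%nat -> (i2 < 2 ^ n)%nat ->
    int2 P (dlo (fst l) (fst s) n i1) (dhi (fst l) (fst s) n i1)
           (dlo (snd l) (snd s) n i2) (dhi (snd l) (snd s) n i2)
    = int2 h (dlo (fst l) (fst s) n i1) (dhi (fst l) (fst s) n i1)
             (dlo (snd l) (snd s) n i2) (dhi (snd l) (snd s) n i2).

Definition is_Pn3 (l s : R*R) (l3 s3 : R) (c : R*R) (c3 : R) (n : nat)
  (h P : R*R -> R -> R) : Prop :=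
  poly3 n c c3 P /\
  forall i1 i2 i3 : nat, (i1 < 2 ^ n)%nat -> (i2 < 2 ^ n)%nat -> (i3 < 2 ^ n)%nat ->
    int3 P (dlo (fst l) (fst s) n i1) (dhi (fst l) (fst s) n i1)
           (dlo (snd l) (snd s) n i2) (dhi (snd l) (snd s) n i2)
           (dlo l3 s3 n i3) (dhi l3 s3 n i3)
    = int3 h (dlo (fst l) (fst s) n i1) (dhi (fst l) (fst s) n i1)
             (dlo (snd l) (snd s) n i2) (dhi (snd l) (snd s) n i2)
             (dlo l3 s3 n i3) (dhi l3 s3 n i3).

Definition gamma_cesaro2 (l s : R*R) (hs : nat -> R*R -> R) (h : R*R -> R) : Prop :=
  forall z : R*R, in_cint (fst l) (fst s) (fst z) -> in_cint (snd l) (snd s) (snd z) ->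
  forall eps : R, 0 < eps -> exists N : nat, forall n : nat, (N <= n)%nat ->
  forall i1 i2 : nat, (i1 < 2 ^ n)%nat -> (i2 < 2 ^ n)%nat ->
    dlo (fst l) (fst s) n i1 <= fst z <= dhi (fst l) (fst s) n i1 ->
    dlo (snd l) (snd s) n i2 <= snd z <= dhi (snd l) (snd s) n i2 ->
    Rabs (/ (fst s / 2 ^ n * (snd s / 2 ^ n)) *
            int2 (hs n) (dlo (fst l) (fst s) n i1) (dhi (fst l) (fst s) n i1)
                        (dlo (snd l) (snd s) n i2) (dhi (snd l) (snd s) n i2)
          - h z) < eps.

Definition gamma_cesaro3 (l s : R*R) (l3 s3 : R) (hs : nat -> R*R -> R -> R)
  (h : R*R -> R -> R) : Prop :=
  forall (z : R*R) (z3 : R), in_cint (fst l) (fst s) (fst z) ->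
    in_cint (snd l) (snd s) (snd z) -> in_cint l3 s3 z3 ->
  forall eps : R, 0 < eps -> exists N : nat, forall n : nat, (N <= n)%nat ->
  forall i1 i2 i3 : nat, (i1 < 2 ^ n)%nat -> (i2 < 2 ^ n)%nat -> (i3 < 2 ^ n)%nat ->
    dlo (fst l) (fst s) n i1 <= fst z <= dhi (fst l) (fst s) n i1 ->
    dlo (snd l) (snd s) n i2 <= snd z <= dhi (snd l) (snd s) n i2 ->
    dlo l3 s3 n i3 <= z3 <= dhi l3 s3 n i3 ->
    Rabs (/ (fst s / 2 ^ n * (snd s / 2 ^ n) * (s3 / 2 ^ n)) *
            int3 (hs n) (dlo (fst l) (fst s) n i1) (dhi (fst l) (fst s) n i1)
                        (dlo (snd l) (snd s) n i2) (dhi (snd l) (snd s) n i2)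
                        (dlo l3 s3 n i3) (dhi l3 s3 n i3)
          - h z z3) < eps.

(* h is the Gamma-Cesaro limit of its approximants P_n(h): every P_n(h) exists
   (it is unique, by the context) and the sequence converges. *)
Definition Pn_limit2 (l s c : R*R) (h : R*R -> R) : Prop :=
  (forall n, exists P, is_Pn2 l s c n h P) /\
  (forall hs : nat -> R*R -> R, (forall n, is_Pn2 l s c n h (hs n)) ->
     gamma_cesaro2 l s hs h).

Definition Pn_limit3 (l s : R*R) (l3 s3 : R) (c : R*R) (c3 : R)
  (h : R*R -> R -> R) : Prop :=
  (forall n, exists P, is_Pn3 l s l3 s3 c c3 n h P) /\
  (forall hs : nat -> R*R -> R -> R, (forall n, is_Pn3 l s l3 s3 c c3 n h (hs n)) ->
     gamma_cesaro3 l s l3 s3 hs h).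

Definition in_box2 (l s z : R*R) : Prop :=
  in_cint (fst l) (fst s) (fst z) /\ in_cint (snd l) (snd s) (snd z).

Definition cont_on_box2 (l s : R*R) (h : R*R -> R) : Prop :=
  forall z, in_box2 l s z ->
    filterlim h (within (in_box2 l s) (locally z)) (locally (h z)).

Definition cont_on_box3 (l s : R*R) (l3 s3 : R) (h : R*R -> R -> R) : Prop :=
  forall z z3, in_box2 l s z -> in_cint l3 s3 z3 ->
    filterlim (fun w : (R*R)*R => h (fst w) (snd w))
      (within (fun w : (R*R)*R => in_box2 l s (fst w) /\ in_cint l3 s3 (snd w))
              (locally (z, z3)))
      (locally (h z z3)).

(* y with y_j = yj and y_j' = yj'; j = true means (j, j') = (1, 2),
   j = false means (j, j') = (2, 1). *)
Definition mky (j : bool) (yj yj' : R) : R*R := if j then (yj, yj') else (yj', yj).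

(* Main.v *)
(* Write y = (y_j, y_j') with d f_1 / d y_j (a, b) <> 0.  Near (a, b), f_1 is strictly
   monotone in y_j, so the intermediate value theorem yields a Lipschitz solution
   y_j = P(x, y_j') of f_1 = 0; since the Jacobian does not vanish, t |-> f_2(x, P(x, t), t)
   is strictly monotone as well, which yields a Lipschitz solution q(x) of the reduced
   equation.  We take p(x, t) = P(x, q(x)), independent of t.

   The approximants exist because the derivatives of the polynomials interpolating the step
   functions [i < k] at the dyadic nodes form a dual basis for the block integrals of
   univariate polynomials; products of two such bases prescribe all block integrals on a
   rectangle.  As P_n(h) and h have the same block integrals, the Gamma-Cesaro averages of
   P_n(h) are block averages of h, which differ from h(z) by O(2^-n) when h is Lipschitz. *)

Require Import Defs.
From Stdlib Require Import Reals Lra Lia Psatz ClassicalEpsilon.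
From Coquelicot Require Import Coquelicot.
Open Scope R_scope.

(** * Polynomials with prescribed block integrals *)

Definition poly1 (c : R) (d : nat) (P : R -> R) : Prop :=
  exists coef : nat -> R, forall t, P t = sum_f_R0 (fun i => coef i * (t - c) ^ i) d.

Lemma poly1_ext c d P Q : (forall t, P t = Q t) -> poly1 c d P -> poly1 c d Q.
Proof. intros E [co Hco]; exists co; intro t; rewrite <- E; apply Hco. Qed.

Lemma poly1_S c d P : poly1 c d P -> poly1 c (S d) P.
Proof.
  intros [co Hco]. exists (fun i => if Nat.leb i d then co i else 0). intro t.
  rewrite tech5, Hco, (proj2 (Nat.leb_gt (S d) d)) by lia.
  rewrite Rmult_0_l, Rplus_0_r. apply sum_eq. intros i Hi.
  now rewrite (proj2 (Nat.leb_le i d)).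
Qed.

Lemma poly1_const c k : poly1 c 0 (fun _ => k).
Proof. exists (fun _ => k). intro t; simpl; ring. Qed.

Lemma poly1_plus c d P Q : poly1 c d P -> poly1 c d Q -> poly1 c d (fun t => P t + Q t).
Proof.
  intros [a Ha] [b Hb]. exists (fun i => a i + b i). intro t.
  rewrite Ha, Hb, <- sum_plus. apply sum_eq; intros; ring.
Qed.

Lemma poly1_scal c d k P : poly1 c d P -> poly1 c d (fun t => k * P t).
Proof.
  intros [a Ha]. exists (fun i => k * a i). intro t.
  rewrite Ha, scal_sum. apply sum_eq; intros; ring.
Qed.

Lemma poly1_sum c d (F : nat -> R -> R) K :
  (forall i, poly1 c d (F i)) -> poly1 c d (fun t => sum_f_R0 (fun i => F i t) K).
Proof.
  intro HF. induction K as [|K IH]; simpl.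
  - exact (HF 0%nat).
  - now apply poly1_plus.
Qed.

Lemma poly1_mul_linear c d x P : poly1 c d P -> poly1 c (S d) (fun t => (t - x) * P t).
Proof.
  intro HP. destruct (poly1_S _ _ _ HP) as [b Hb]. destruct HP as [a Ha].
  exists (fun i => match i with 0%nat => 0 | S j => a j end + (c - x) * b i). intro t.
  rewrite (sum_eq _ (fun i => match i with 0%nat => 0 | S j => a j end * (t - c) ^ i
                          + (c - x) * b i * (t - c) ^ i)) by (intros; ring).
  rewrite sum_plus.
  replace ((t - x) * P t) with ((t - c) * P t + (c - x) * P t) by ring.
  f_equal.
  - rewrite decomp_sum by lia. simpl pred. rewrite Ha, scal_sum.
    simpl. rewrite Rmult_0_l, Rplus_0_l. apply sum_eq; intros; ring.
  - rewrite Hb, scal_sum. apply sum_eq; intros; ring.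
Qed.

Lemma is_derive_sum_f_R0 (F : nat -> R -> R) (dF : nat -> R) t n :
  (forall i, is_derive (F i) t (dF i)) ->
  is_derive (fun u => sum_f_R0 (fun i => F i u) n) t (sum_f_R0 dF n).
Proof.
  intro HF. induction n as [|n IH]; simpl.
  - apply HF.
  - exact (is_derive_plus (fun u => sum_f_R0 (fun i => F i u) n) (F (S n)) _ _ _ IH (HF _)).
Qed.

Lemma poly1_derive c d G : poly1 c (S d) G ->
  exists P, poly1 c d P /\ forall t, is_derive G t (P t).
Proof.
  intros [a Ha].
  exists (fun t => sum_f_R0 (fun i => a (S i) * INR (S i) * (t - c) ^ i) d). split.
  { exists (fun i => a (S i) * INR (S i)). reflexivity. }
  intro t.
  apply is_derive_ext with
    (f := fun u => a 0%nat * (u - c) ^ 0 + sum_f_R0 (fun i => a (S i) * (u - c) ^ S i) d).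
  { intro u. rewrite Ha, (decomp_sum (fun i => a i * (u - c) ^ i) (S d)) by lia. reflexivity. }
  rewrite <- (Rplus_0_l (sum_f_R0 _ d)).
  apply (is_derive_plus (fun u => a 0%nat * (u - c) ^ 0)).
  - auto_derive; [exact I | simpl; ring].
  - apply is_derive_sum_f_R0. intro i.
    auto_derive; [exact I |]. change (match i with 0%nat => 1 | S _ => INR i + 1 end) with (INR (S i)).
    unfold Rminus; ring.
Qed.

Lemma poly1_continuous c d P t : poly1 c d P -> continuous P t.
Proof.
  intro HP. destruct (poly1_derive _ _ _ (poly1_S _ _ _ HP)) as [Q [_ HQ]].
  apply (@ex_derive_continuous R_AbsRing R_NormedModule). eexists; apply HQ.
Qed.

Lemma ex_RInt_poly1 c d P a b : poly1 c d P -> ex_RInt P a b.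
Proof.
  intro HP. apply (@ex_RInt_continuous R_CompleteNormedModule).
  intros; exact (poly1_continuous _ _ _ _ HP).
Qed.

Fixpoint node_poly (x : nat -> R) (K : nat) (t : R) : R :=
  match K with
  | 0%nat => t - x 0%nat
  | S K' => (t - x K) * node_poly x K' t
  end.

Lemma node_poly_poly1 c x K : poly1 c (S K) (node_poly x K).
Proof.
  induction K as [|K IH].
  - apply (poly1_ext _ _ (fun t => (t - x 0%nat) * 1)); [intro; simpl; ring|].
    apply poly1_mul_linear, poly1_const.
  - exact (poly1_mul_linear _ _ _ _ IH).
Qed.

Lemma node_poly_node x K k : (k <= K)%nat -> node_poly x K (x k) = 0.
Proof.
  induction K as [|K IH]; intro Hk; simpl.
  - replace k with 0%nat by lia. ring.
  - destruct (Nat.eq_dec k (S K)) as [->|]; [ring|].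
    rewrite IH by lia. ring.
Qed.

Lemma node_poly_neq0 x K t : (forall k, (k <= K)%nat -> t <> x k) -> node_poly x K t <> 0.
Proof.
  induction K as [|K IH]; intro Ht; simpl.
  - specialize (Ht 0%nat (le_n _)). lra.
  - apply Rmult_integral_contrapositive_currified.
    + specialize (Ht (S K) (le_n _)). lra.
    + apply IH. intros; apply Ht; lia.
Qed.

Section Interpolation.

Variables (c : R) (x : nat -> R).
Hypothesis x_incr : forall i j, (i < j)%nat -> x i < x j.

(* Newton's form: add a multiple of the node polynomial of the previous nodes. *)
Lemma poly1_interpolation K (y : nat -> R) :
  exists G, poly1 c K G /\ forall k, (k <= K)%nat -> G (x k) = y k.
Proof.
  induction K as [|K [G [HG HGy]]].
  - exists (fun _ => y 0%nat). split; [apply poly1_const|].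
    intros k Hk. now replace k with 0%nat by lia.
  - set (W := node_poly x K (x (S K))).
    assert (HW : W <> 0).
    { apply node_poly_neq0. intros j Hj. assert (x j < x (S K)) by (apply x_incr; lia). lra. }
    exists (fun t => G t + (y (S K) - G (x (S K))) / W * node_poly x K t). split.
    + apply poly1_plus; [now apply poly1_S|]. apply poly1_scal, node_poly_poly1.
    + intros k Hk. destruct (Nat.eq_dec k (S K)) as [->|].
      * fold W. field. exact HW.
      * rewrite node_poly_node, HGy by lia. ring.
Qed.

(* Differentiate the interpolant of the step function [i < k] at the nodes. *)
Lemma poly1_moment_dual K i : exists phi, poly1 c K phi /\
  forall k, (k <= K)%nat -> RInt phi (x k) (x (S k)) = if Nat.eqb i k then 1 else 0.
Proof.
  destruct (poly1_interpolation (S K) (fun k => if Nat.ltb i k then 1 else 0)) as [G [HG HGy]].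
  destruct (poly1_derive _ _ _ HG) as [phi [Hphi HdG]].
  exists phi. split; [exact Hphi|]. intros k Hk.
  rewrite (@is_RInt_unique R_CompleteNormedModule _ _ _ (G (x (S k)) - G (x k))).
  - (* The equation lives in the carrier of [R_CompleteNormedModule]; [ring] needs type [R]. *)
    rewrite !HGy by lia. lazymatch goal with |- ?l = ?r => change (@eq R l r) end.
    destruct (Nat.eqb_spec i k), (Nat.ltb_spec i (S k)), (Nat.ltb_spec i k); try lia; ring.
  - apply (@is_RInt_derive R_CompleteNormedModule); intros.
    + apply HdG.
    + exact (poly1_continuous _ _ _ _ Hphi).
Qed.

Lemma poly1_moment_dual_family K : exists phi : nat -> R -> R, forall i, poly1 c K (phi i) /\
  forall k, (k <= K)%nat -> RInt (phi i) (x k) (x (S k)) = if Nat.eqb i k then 1 else 0.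
Proof.
  exists (fun i => proj1_sig (constructive_indefinite_description _ (poly1_moment_dual K i))).
  intro i. exact (proj2_sig (constructive_indefinite_description _ (poly1_moment_dual K i))).
Qed.

End Interpolation.

Lemma sum_kronecker (g : nat -> R) k K :
  sum_f_R0 (fun i => g i * (if Nat.eqb i k then 1 else 0)) K = if Nat.leb k K then g k else 0.
Proof.
  induction K as [|K IH]; cbn [sum_f_R0].
  - destruct (Nat.eqb_spec 0 k), (Nat.leb_spec k 0); subst; lia || ring.
  - rewrite IH. destruct (Nat.eqb_spec (S K) k), (Nat.leb_spec k K), (Nat.leb_spec k (S K));
      subst; lia || ring.
Qed.

Lemma sum_kronecker_le (g : nat -> R) k K : (k <= K)%nat ->
  sum_f_R0 (fun i => g i * (if Nat.eqb i k then 1 else 0)) K = g k.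
Proof. intro Hk. now rewrite sum_kronecker, (proj2 (Nat.leb_le k K) Hk). Qed.

(* Coquelicot states these for a generic module; the [_R] forms match real expressions such
   as [k * f t] syntactically, so that they can be used for rewriting. *)
Lemma ex_RInt_continuous_R (f : R -> R) a b : (forall z, continuous f z) -> ex_RInt f a b.
Proof. intro Hf. apply (@ex_RInt_continuous R_CompleteNormedModule). intros; apply Hf. Qed.

Lemma ex_RInt_scal_R (f : R -> R) a b k : ex_RInt f a b -> ex_RInt (fun t => k * f t) a b.
Proof. exact (ex_RInt_scal f a b k). Qed.

Lemma RInt_scal_R (f : R -> R) a b k : ex_RInt f a b ->
  RInt (fun t => k * f t) a b = k * RInt f a b.
Proof. exact (RInt_scal f a b k). Qed.

Lemma ex_RInt_minus_R (f g : R -> R) a b : ex_RInt f a b -> ex_RInt g a b ->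
  ex_RInt (fun t => f t - g t) a b.
Proof. exact (ex_RInt_minus f g a b). Qed.

Lemma RInt_minus_R (f g : R -> R) a b : ex_RInt f a b -> ex_RInt g a b ->
  RInt (fun t => f t - g t) a b = RInt f a b - RInt g a b.
Proof. exact (RInt_minus f g a b). Qed.

Lemma RInt_const_R a b (k : R) : RInt (fun _ => k) a b = (b - a) * k.
Proof. exact (RInt_const a b k). Qed.

Lemma ex_RInt_sum_R (F : nat -> R -> R) a b K : (forall i, ex_RInt (F i) a b) ->
  ex_RInt (fun t => sum_f_R0 (fun i => F i t) K) a b.
Proof.
  intro HF. induction K as [|K IH]; simpl; [apply HF|].
  exact (ex_RInt_plus _ (F (S K)) a b IH (HF _)).
Qed.

Lemma RInt_sum_R (F : nat -> R -> R) a b K : (forall i, ex_RInt (F i) a b) ->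
  RInt (fun t => sum_f_R0 (fun i => F i t) K) a b = sum_f_R0 (fun i => RInt (F i) a b) K.
Proof.
  intro HF. induction K as [|K IH]; simpl; [reflexivity|].
  rewrite <- IH. exact (RInt_plus _ (F (S K)) a b (ex_RInt_sum_R F a b K HF) (HF _)).
Qed.

Lemma pow2_pos n : 0 < 2 ^ n.
Proof. apply pow_lt; lra. Qed.

Lemma dlo_lt l s n i j : 0 < s -> (i < j)%nat -> dlo l s n i < dlo l s n j.
Proof.
  intros Hs Hij. unfold dlo, Rdiv. apply lt_INR in Hij.
  pose proof (Rinv_0_lt_compat _ (pow2_pos n)). apply Rplus_lt_compat_l.
  apply Rmult_lt_compat_r; [lra|]. apply Rmult_lt_compat_r; lra.
Qed.

Lemma dhi_minus_dlo l s n k : dhi l s n k - dlo l s n k = s / 2 ^ n.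
Proof. unfold dhi, dlo. rewrite S_INR. field. apply Rgt_not_eq, pow2_pos. Qed.

Lemma dlo_le_dhi l s n k : 0 < s -> dlo l s n k <= dhi l s n k.
Proof.
  intro Hs. pose proof (dhi_minus_dlo l s n k).
  pose proof (Rdiv_lt_0_compat _ _ Hs (pow2_pos n)). lra.
Qed.

Lemma dlo_ge l s n k : 0 < s -> l <= dlo l s n k.
Proof.
  intro Hs. unfold dlo. pose proof (pos_INR k).
  pose proof (Rdiv_lt_0_compat _ _ Hs (pow2_pos n)).
  assert (0 <= INR k * (s / 2 ^ n)) by (apply Rmult_le_pos; lra). unfold Rdiv in *. lra.
Qed.

Lemma dhi_le l s n k : 0 < s -> (k < 2 ^ n)%nat -> dhi l s n k <= l + s.
Proof.
  intros Hs Hk. unfold dhi. pose proof (pow2_pos n).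
  assert (INR (S k) <= 2 ^ n) by (rewrite <- (pow_INR 2); apply le_INR; lia).
  assert (INR (S k) * s / 2 ^ n <= s).
  { unfold Rdiv. apply (Rmult_le_reg_r (2 ^ n)); auto.
    rewrite Rmult_assoc, Rinv_l by lra. nra. }
  lra.
Qed.

Definition block2 (l s : R*R) (n i1 i2 : nat) (h : R*R -> R) : R :=
  int2 h (dlo (fst l) (fst s) n i1) (dhi (fst l) (fst s) n i1)
         (dlo (snd l) (snd s) n i2) (dhi (snd l) (snd s) n i2).

Definition in_block2 (l s : R*R) (n i1 i2 : nat) (z : R*R) : Prop :=
  dlo (fst l) (fst s) n i1 <= fst z <= dhi (fst l) (fst s) n i1 /\
  dlo (snd l) (snd s) n i2 <= snd z <= dhi (snd l) (snd s) n i2.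

Lemma in_block2_in_box2 (l s : R*R) n i1 i2 z : 0 < fst s -> 0 < snd s ->
  (i1 < 2 ^ n)%nat -> (i2 < 2 ^ n)%nat -> in_block2 l s n i1 i2 z -> in_box2 l s z.
Proof.
  intros H1 H2 Hi1 Hi2 [Hz1 Hz2].
  pose proof (dlo_ge (fst l) _ n i1 H1). pose proof (dhi_le (fst l) _ n i1 H1 Hi1).
  pose proof (dlo_ge (snd l) _ n i2 H2). pose proof (dhi_le (snd l) _ n i2 H2 Hi2).
  split; unfold in_cint; lra.
Qed.

Lemma block2_ext (l s : R*R) n i1 i2 h H : 0 < fst s -> 0 < snd s ->
  (forall z, in_block2 l s n i1 i2 z -> h z = H z) -> block2 l s n i1 i2 h = block2 l s n i1 i2 H.
Proof.
  intros H1 H2 Hh. unfold block2, int2.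
  pose proof (dlo_le_dhi (fst l) _ n i1 H1). pose proof (dlo_le_dhi (snd l) _ n i2 H2).
  apply RInt_ext. intros u Hu. rewrite Rmin_left, Rmax_right in Hu by lra.
  apply RInt_ext. intros v Hv. rewrite Rmin_left, Rmax_right in Hv by lra.
  apply Hh. split; simpl; lra.
Qed.

Lemma poly2_plus n c P Q : poly2 n c P -> poly2 n c Q -> poly2 n c (fun z => P z + Q z).
Proof.
  intros [a Ha] [b Hb]. exists (fun i j => a i j + b i j). intro z.
  rewrite Ha, Hb, <- sum_plus. apply sum_eq; intros.
  rewrite <- sum_plus. apply sum_eq; intros. ring.
Qed.

Lemma poly2_sum n c (F : nat -> R*R -> R) K :
  (forall i, poly2 n c (F i)) -> poly2 n c (fun z => sum_f_R0 (fun i => F i z) K).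
Proof.
  intro HF. induction K as [|K IH]; simpl; [apply HF|]. now apply poly2_plus.
Qed.

Lemma poly2_tensor n c phi psi :
  poly1 (fst c) (2 ^ n - 1) phi -> poly1 (snd c) (2 ^ n - 1) psi ->
  poly2 n c (fun z => phi (fst z) * psi (snd z)).
Proof.
  intros [a Ha] [b Hb]. exists (fun i j => a i * b j). intro z.
  rewrite Ha, Hb, Rmult_comm, scal_sum. apply sum_eq; intros.
  rewrite scal_sum. apply sum_eq; intros. ring.
Qed.

Definition int2_integrable (P : R*R -> R) : Prop :=
  (forall u c d, ex_RInt (fun v => P (u, v)) c d) /\
  (forall a b c d, ex_RInt (fun u => RInt (fun v => P (u, v)) c d) a b).

(* With dual families phi_i, psi_j for the two factors,
   P(u, v) = sum_(i,j) m i j phi_i(u) psi_j(v) has block moments m. *)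
Lemma poly2_block_moments (l s c : R*R) n (m : nat -> nat -> R) :
  0 < fst s -> 0 < snd s -> exists P, poly2 n c P /\ int2_integrable P /\
  forall i1 i2, (i1 < 2 ^ n)%nat -> (i2 < 2 ^ n)%nat -> block2 l s n i1 i2 P = m i1 i2.
Proof.
  intros H1 H2. set (K := (2 ^ n - 1)%nat).
  destruct (poly1_moment_dual_family (fst c) _ (fun i j => dlo_lt (fst l) _ n i j H1) K)
    as [phi Hphi].
  destruct (poly1_moment_dual_family (snd c) _ (fun i j => dlo_lt (snd l) _ n i j H2) K)
    as [psi Hpsi].
  set (chi := fun i v => sum_f_R0 (fun j => m i j * psi j v) K).
  assert (Hchi : forall i, poly1 (snd c) K (chi i)).
  { intro i. apply poly1_sum. intro j. apply poly1_scal, Hpsi. }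
  assert (Ephi : forall i a b, ex_RInt (phi i) a b) by (intros; eapply ex_RInt_poly1, Hphi).
  assert (Epsi : forall j a b, ex_RInt (psi j) a b) by (intros; eapply ex_RInt_poly1, Hpsi).
  assert (Echi : forall i a b, ex_RInt (chi i) a b) by (intros; eapply ex_RInt_poly1, Hchi).
  assert (Hinner : forall u c d, RInt (fun v => sum_f_R0 (fun i => phi i u * chi i v) K) c d
                              = sum_f_R0 (fun i => RInt (chi i) c d * phi i u) K).
  { intros u c' d. rewrite RInt_sum_R by (intro; apply ex_RInt_scal_R, Echi).
    apply sum_eq. intros i _. rewrite RInt_scal_R by apply Echi. ring. }
  exists (fun z => sum_f_R0 (fun i => phi i (fst z) * chi i (snd z)) K). split; [|split].
  - apply poly2_sum. intro i. apply poly2_tensor; [apply Hphi | apply Hchi].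
  - split; simpl.
    + intros u c' d. apply ex_RInt_sum_R. intro i. apply ex_RInt_scal_R, Echi.
    + intros a b c' d. apply (ex_RInt_ext (fun u => sum_f_R0 (fun i => RInt (chi i) c' d * phi i u) K)).
      * intros u _. symmetry. apply Hinner.
      * apply ex_RInt_sum_R. intro i. apply ex_RInt_scal_R, Ephi.
  - intros i1 i2 Hi1 Hi2. unfold block2, int2. simpl.
    assert (Hchi_mom : forall i, RInt (chi i) (dlo (snd l) (snd s) n i2) (dhi (snd l) (snd s) n i2)
                                 = m i i2).
    { intro i. unfold chi. rewrite RInt_sum_R by (intro; apply ex_RInt_scal_R, Epsi).
      rewrite (sum_eq _ (fun j => m i j * (if Nat.eqb j i2 then 1 else 0))).
      - apply (sum_kronecker_le (m i)). unfold K; lia.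
      - intros j _. rewrite RInt_scal_R, (proj2 (Hpsi j)) by (apply Epsi || (unfold K; lia)).
        reflexivity. }
    rewrite (RInt_ext _ (fun u => sum_f_R0 (fun i => m i i2 * phi i u) K)).
    + rewrite RInt_sum_R by (intro; apply ex_RInt_scal_R, Ephi).
      rewrite (sum_eq _ (fun i => m i i2 * (if Nat.eqb i i1 then 1 else 0))).
      * apply (sum_kronecker_le (fun i => m i i2)). unfold K; lia.
      * intros i _. rewrite RInt_scal_R, (proj2 (Hphi i)) by (apply Ephi || (unfold K; lia)).
        reflexivity.
    + intros u _. rewrite Hinner. apply sum_eq. intros i _. rewrite Hchi_mom. ring.
Qed.

(** * Lipschitz functions and their block averages *)

Lemma lipschitz_continuous (f : R -> R) K : 0 <= K ->
  (forall u v, Rabs (f u - f v) <= K * Rabs (u - v)) -> forall x, continuous f x.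
Proof.
  intros HK Hf x. apply filterlim_locally. intro eps.
  assert (Hd : 0 < eps / (K + 1)) by (apply Rdiv_lt_0_compat; [apply cond_pos | lra]).
  exists (mkposreal _ Hd). intros u Hu. change (Rabs (u - x) < eps / (K + 1)) in Hu.
  change (Rabs (f u - f x) < eps).
  assert (K * (eps / (K + 1)) = eps - eps / (K + 1)) by (field; lra).
  assert (K * Rabs (u - x) <= K * (eps / (K + 1))) by (apply Rmult_le_compat_l; lra).
  pose proof (Hf u x). lra.
Qed.

Definition l1_dist (z z' : R*R) : R := Rabs (fst z - fst z') + Rabs (snd z - snd z').

Lemma l1_dist_refl z : l1_dist z z = 0.
Proof. unfold l1_dist. rewrite !Rminus_diag, Rabs_R0. ring. Qed.

Lemma l1_dist_sym z z' : l1_dist z z' = l1_dist z' z.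
Proof. unfold l1_dist. now rewrite (Rabs_minus_sym (fst z)), (Rabs_minus_sym (snd z)). Qed.

Lemma l1_dist_nonneg z z' : 0 <= l1_dist z z'.
Proof. unfold l1_dist. pose proof (Rabs_pos (fst z - fst z')). pose proof (Rabs_pos (snd z - snd z')). lra. Qed.

Definition lip2 (H : R*R -> R) (L : R) : Prop :=
  0 <= L /\ forall z z', Rabs (H z - H z') <= L * l1_dist z z'.

Lemma lip2_continuous_snd H L u v : lip2 H L -> continuous (fun v => H (u, v)) v.
Proof.
  intros [HL Hl]. apply (lipschitz_continuous _ L HL). intros v1 v2.
  eapply Rle_trans; [apply Hl|]. unfold l1_dist; simpl. rewrite Rminus_diag, Rabs_R0, Rplus_0_l. lra.
Qed.

Lemma lip2_continuous_RInt H L c d u : lip2 H L ->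
  continuous (fun u => RInt (fun v => H (u, v)) c d) u.
Proof.
  intro HH. pose proof HH as [HL Hl].
  assert (E : forall u, ex_RInt (fun v => H (u, v)) c d).
  { intro; apply ex_RInt_continuous_R; intro; eapply lip2_continuous_snd, HH. }
  apply (lipschitz_continuous _ (Rabs (d - c) * L)); [apply Rmult_le_pos; [apply Rabs_pos | lra]|].
  intros u1 u2. rewrite <- RInt_minus_R by apply E. rewrite Rmult_assoc.
  apply (norm_RInt_le_const_abs (fun v => H (u1, v) - H (u2, v)) c d).
  - intros v _. eapply Rle_trans; [apply Hl|]. unfold l1_dist; simpl. rewrite Rminus_diag, Rabs_R0, Rplus_0_r. lra.
  - apply (RInt_correct (V := R_CompleteNormedModule)), ex_RInt_minus_R; apply E.
Qed.

Lemma lip2_int2_integrable H L : lip2 H L -> int2_integrable H.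
Proof.
  intro HH. split; intros; apply ex_RInt_continuous_R; intro.
  - eapply lip2_continuous_snd, HH.
  - eapply lip2_continuous_RInt, HH.
Qed.

Lemma lip2_near H L z eps : lip2 H L -> 0 < eps -> exists del : posreal, forall y,
  Rabs (fst y - fst z) < del -> Rabs (snd y - snd z) < del -> Rabs (H y - H z) < eps.
Proof.
  intros [HL Hl] Heps.
  assert (Hd : 0 < eps / (2 * L + 1)) by (apply Rdiv_lt_0_compat; lra).
  exists (mkposreal _ Hd). simpl. intros y Hy1 Hy2.
  assert (2 * L * (eps / (2 * L + 1)) = eps - eps / (2 * L + 1)) by (field; lra).
  pose proof (Hl y z). unfold l1_dist in *. pose proof (Rabs_pos (fst y - fst z)). pose proof (Rabs_pos (snd y - snd z)).
  nra.
Qed.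

Lemma int2_const_dev H a b c d y e : int2_integrable H -> a <= b -> c <= d ->
  (forall u v, a <= u <= b -> c <= v <= d -> Rabs (H (u, v) - y) <= e) ->
  Rabs (int2 H a b c d - y * ((b - a) * (d - c))) <= e * ((b - a) * (d - c)).
Proof.
  intros [Ei Eo] Hab Hcd Hdev. unfold int2.
  assert (Hin : forall u, a <= u <= b ->
            Rabs (RInt (fun v => H (u, v)) c d - (d - c) * y) <= (d - c) * e).
  { intros u Hu. rewrite <- (RInt_const_R c d y), <- RInt_minus_R; [| apply Ei | apply ex_RInt_const].
    apply abs_RInt_le_const; auto.
    apply ex_RInt_minus_R; [apply Ei | apply ex_RInt_const]. }
  replace (y * ((b - a) * (d - c))) with ((b - a) * ((d - c) * y)) by ring.
  rewrite <- (RInt_const_R a b), <- RInt_minus_R; [| apply Eo | apply ex_RInt_const].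
  replace (e * ((b - a) * (d - c))) with ((b - a) * ((d - c) * e)) by ring.
  apply abs_RInt_le_const; auto.
  apply ex_RInt_minus_R; [apply Eo | apply ex_RInt_const].
Qed.

Lemma lip2_block_average_dev (l s : R*R) H L n i1 i2 z :
  0 < fst s -> 0 < snd s -> lip2 H L -> in_block2 l s n i1 i2 z ->
  Rabs (/ (fst s / 2 ^ n * (snd s / 2 ^ n)) * block2 l s n i1 i2 H - H z)
  <= L * (fst s + snd s) / 2 ^ n.
Proof.
  intros H1 H2 HH [Hz1 Hz2]. pose proof HH as [HL Hl].
  set (w1 := fst s / 2 ^ n). set (w2 := snd s / 2 ^ n).
  pose proof (dhi_minus_dlo (fst l) (fst s) n i1) as Ew1.
  pose proof (dhi_minus_dlo (snd l) (snd s) n i2) as Ew2. fold w1 w2 in Ew1, Ew2.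
  assert (Hw1 : 0 < w1) by apply (Rdiv_lt_0_compat _ _ H1 (pow2_pos n)).
  assert (Hw2 : 0 < w2) by apply (Rdiv_lt_0_compat _ _ H2 (pow2_pos n)).
  assert (Hdev : Rabs (block2 l s n i1 i2 H - H z * (w1 * w2)) <= L * (w1 + w2) * (w1 * w2)).
  { rewrite <- Ew1, <- Ew2 at 1. unfold block2.
    rewrite <- Ew1, <- Ew2 at 2.
    apply int2_const_dev; [eapply lip2_int2_integrable, HH | lra | lra |].
    intros u v Hu Hv. eapply Rle_trans; [apply Hl|]. unfold l1_dist; simpl.
    apply Rmult_le_compat_l; [lra|].
    apply Rplus_le_compat; apply Rabs_le; lra. }
  replace (L * (fst s + snd s) / 2 ^ n) with (L * (w1 + w2)) by (unfold w1, w2; field; apply Rgt_not_eq, pow2_pos).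
  replace (/ (w1 * w2) * block2 l s n i1 i2 H - H z)
    with (/ (w1 * w2) * (block2 l s n i1 i2 H - H z * (w1 * w2))) by (field; lra).
  rewrite Rabs_mult, Rabs_inv, (Rabs_pos_eq (w1 * w2)) by nra.
  apply (Rmult_le_reg_l (w1 * w2)); [nra|].
  rewrite <- Rmult_assoc, Rinv_r, Rmult_1_l by nra. lra.
Qed.

Lemma pow2_div_small K eps : 0 < eps -> exists N, forall n, (N <= n)%nat -> K / 2 ^ n < eps.
Proof.
  intro Heps. set (A := Rabs K + 1).
  assert (HA : 0 < A) by (unfold A; pose proof (Rabs_pos K); lra).
  destruct (archimed_cor1 (eps / A) (Rdiv_lt_0_compat _ _ Heps HA)) as [N [HN HN0]].
  exists N. intros n Hn.
  assert (HNn : INR N <= 2 ^ n).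
  { rewrite <- (pow_INR 2). apply le_INR. pose proof (Nat.pow_gt_lin_r 2 n). lia. }
  assert (HN' : 0 < INR N) by (apply lt_0_INR; lia).
  assert (/ 2 ^ n <= / INR N) by (apply Rinv_le_contravar; lra).
  assert (K / 2 ^ n <= A * / 2 ^ n).
  { unfold Rdiv. apply Rmult_le_compat_r; [left; apply Rinv_0_lt_compat, pow2_pos|].
    pose proof (Rle_abs K). unfold A; lra. }
  assert (A * / INR N < A * (eps / A)) by (apply Rmult_lt_compat_l; lra).
  replace (A * (eps / A)) with eps in * by (field; lra).
  assert (A * / 2 ^ n <= A * / INR N) by (apply Rmult_le_compat_l; lra).
  lra.
Qed.

Lemma gamma_cesaro2_of_lip2 (l s : R*R) h H L (hs : nat -> R*R -> R) :
  0 < fst s -> 0 < snd s -> lip2 H L -> (forall z, in_box2 l s z -> h z = H z) ->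
  (forall n i1 i2, (i1 < 2 ^ n)%nat -> (i2 < 2 ^ n)%nat ->
     block2 l s n i1 i2 (hs n) = block2 l s n i1 i2 H) ->
  gamma_cesaro2 l s hs h.
Proof.
  intros H1 H2 HH Hh Hhs z Hz1 Hz2 eps Heps.
  destruct (pow2_div_small (L * (fst s + snd s)) eps Heps) as [N HN].
  exists N. intros n Hn i1 i2 Hi1 Hi2 Hzz1 Hzz2.
  change (Rabs (/ (fst s / 2 ^ n * (snd s / 2 ^ n)) * block2 l s n i1 i2 (hs n) - h z) < eps).
  rewrite Hhs, Hh by (try split; assumption).
  eapply Rle_lt_trans; [apply (lip2_block_average_dev l s H L) | apply HN]; auto.
  split; assumption.
Qed.

Lemma Pn_limit2_of_lip2 (l s c : R*R) h H L : 0 < fst s -> 0 < snd s -> lip2 H L ->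
  (forall z, in_box2 l s z -> h z = H z) -> Pn_limit2 l s c h.
Proof.
  intros H1 H2 HH Hh. split.
  - intro n.
    destruct (poly2_block_moments l s c n (fun i1 i2 => block2 l s n i1 i2 h) H1 H2)
      as [P [HP [_ HPm]]].
    exists P. exact (conj HP HPm).
  - intros hs Hhs. apply (gamma_cesaro2_of_lip2 l s h H L); auto.
    intros n i1 i2 Hi1 Hi2. transitivity (block2 l s n i1 i2 h); [exact (proj2 (Hhs n) i1 i2 Hi1 Hi2)|].
    apply block2_ext; auto. intros z Hz. apply Hh, (in_block2_in_box2 l s n i1 i2); auto.
Qed.

Lemma int3_const_last (g : R*R -> R) a1 b1 a2 b2 a3 b3 : int2_integrable g ->
  int3 (fun z _ => g z) a1 b1 a2 b2 a3 b3 = (b3 - a3) * int2 g a1 b1 a2 b2.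
Proof.
  intros [Ei Eo]. unfold int3, int2.
  rewrite <- RInt_scal_R by apply Eo. apply RInt_ext. intros u _.
  rewrite <- RInt_scal_R by apply Ei. apply RInt_ext. intros v _. apply RInt_const_R.
Qed.

Lemma poly3_const_last n c c3 P : poly2 n c P -> poly3 n c c3 (fun z _ => P z).
Proof.
  intros [co Hco]. exists (fun i1 i2 i3 => co i1 i2 * (if Nat.eqb i3 0 then 1 else 0)).
  intros z z3. rewrite Hco. apply sum_eq; intros i1 _. apply sum_eq; intros i2 _.
  rewrite (sum_eq _ (fun i3 => co i1 i2 * (fst z - fst c) ^ i1 * (snd z - snd c) ^ i2
                                 * (z3 - c3) ^ i3 * (if Nat.eqb i3 0 then 1 else 0)))
    by (intros; ring).
  rewrite sum_kronecker_le by lia. simpl; ring.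
Qed.

Definition block3 (l s : R*R) (l3 s3 : R) (n i1 i2 i3 : nat) (h : R*R -> R -> R) : R :=
  int3 h (dlo (fst l) (fst s) n i1) (dhi (fst l) (fst s) n i1)
         (dlo (snd l) (snd s) n i2) (dhi (snd l) (snd s) n i2)
         (dlo l3 s3 n i3) (dhi l3 s3 n i3).

Lemma block3_const_last (l s : R*R) l3 s3 n i1 i2 i3 (h H : R*R -> R) :
  0 < fst s -> 0 < snd s -> (i1 < 2 ^ n)%nat -> (i2 < 2 ^ n)%nat -> int2_integrable H ->
  (forall z, in_box2 l s z -> h z = H z) ->
  block3 l s l3 s3 n i1 i2 i3 (fun z _ => h z) = s3 / 2 ^ n * block2 l s n i1 i2 H.
Proof.
  intros H1 H2 Hi1 Hi2 HI Hh.
  unfold block3, block2. rewrite <- (dhi_minus_dlo l3 s3 n i3), <- int3_const_last by exact HI.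
  pose proof (dlo_le_dhi (fst l) _ n i1 H1). pose proof (dlo_le_dhi (snd l) _ n i2 H2).
  unfold int3. apply RInt_ext. intros u Hu. rewrite Rmin_left, Rmax_right in Hu by lra.
  apply RInt_ext. intros v Hv. rewrite Rmin_left, Rmax_right in Hv by lra.
  rewrite Hh; [reflexivity|]. apply (in_block2_in_box2 l s n i1 i2); auto. split; simpl; lra.
Qed.

Lemma Pn_limit3_of_lip2 (l s : R*R) l3 s3 c c3 h H L :
  0 < fst s -> 0 < snd s -> 0 < s3 -> lip2 H L -> (forall z, in_box2 l s z -> h z = H z) ->
  Pn_limit3 l s l3 s3 c c3 (fun z _ => h z).
Proof.
  intros H1 H2 H3 HH Hh. pose proof (lip2_int2_integrable _ _ HH) as HI.
  assert (Hb3 : forall n i1 i2 i3, (i1 < 2 ^ n)%nat -> (i2 < 2 ^ n)%nat ->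
            block3 l s l3 s3 n i1 i2 i3 (fun z _ => h z) = s3 / 2 ^ n * block2 l s n i1 i2 H)
    by (intros; apply block3_const_last; auto).
  split.
  - intro n.
    destruct (poly2_block_moments l s c n (fun i1 i2 => block2 l s n i1 i2 H) H1 H2)
      as [P [HP [HPI HPm]]].
    exists (fun z _ => P z). split; [now apply poly3_const_last|].
    intros i1 i2 i3 Hi1 Hi2 Hi3.
    change (block3 l s l3 s3 n i1 i2 i3 (fun z _ => P z)
            = block3 l s l3 s3 n i1 i2 i3 (fun z _ => h z)).
    rewrite (Hb3 n i1 i2 i3), (block3_const_last l s l3 s3 n i1 i2 i3 P P), HPm by auto.
    reflexivity.
  - intros hs Hhs z z3 Hz1 Hz2 _ eps Heps.
    destruct (pow2_div_small (L * (fst s + snd s)) eps Heps) as [N HN].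
    exists N. intros n Hn i1 i2 i3 Hi1 Hi2 Hi3 Hzz1 Hzz2 _.
    assert (E : block3 l s l3 s3 n i1 i2 i3 (hs n) = s3 / 2 ^ n * block2 l s n i1 i2 H)
      by (rewrite <- (Hb3 n i1 i2 i3) by auto; exact (proj2 (Hhs n) i1 i2 i3 Hi1 Hi2 Hi3)).
    change (Rabs (/ (fst s / 2 ^ n * (snd s / 2 ^ n) * (s3 / 2 ^ n))
                   * block3 l s l3 s3 n i1 i2 i3 (hs n) - h z) < eps).
    pose proof (pow2_pos n).
    assert (0 < s3 / 2 ^ n) by (apply Rdiv_lt_0_compat; auto).
    assert (0 < fst s / 2 ^ n) by (apply Rdiv_lt_0_compat; auto).
    assert (0 < snd s / 2 ^ n) by (apply Rdiv_lt_0_compat; auto).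
    rewrite E, Hh by (split; assumption).
    replace (/ (fst s / 2 ^ n * (snd s / 2 ^ n) * (s3 / 2 ^ n)) * (s3 / 2 ^ n * block2 l s n i1 i2 H))
      with (/ (fst s / 2 ^ n * (snd s / 2 ^ n)) * block2 l s n i1 i2 H) by (field; lra).
    eapply Rle_lt_trans; [apply (lip2_block_average_dev l s H L) | apply HN]; auto.
    split; assumption.
Qed.

Lemma cont_on_box2_of_lip2 (l s : R*R) h H L : lip2 H L ->
  (forall z, in_box2 l s z -> h z = H z) -> cont_on_box2 l s h.
Proof.
  intros HH Hh z Hz. apply filterlim_locally. intro eps.
  destruct (lip2_near H L z eps HH (cond_pos eps)) as [del Hdel].
  exists del. intros y [Hy1 Hy2] Hy. change (Rabs (h y - h z) < eps).
  rewrite !Hh by assumption. now apply Hdel.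
Qed.

Lemma cont_on_box3_of_lip2 (l s : R*R) l3 s3 h H L : lip2 H L ->
  (forall z, in_box2 l s z -> h z = H z) -> cont_on_box3 l s l3 s3 (fun z _ => h z).
Proof.
  intros HH Hh z z3 Hz _. apply filterlim_locally. intro eps.
  destruct (lip2_near H L z eps HH (cond_pos eps)) as [del Hdel].
  exists del. intros [y y3] [[Hy1 Hy2] _] [Hy _]. change (Rabs (h y - h z) < eps).
  rewrite !Hh by assumption. now apply Hdel.
Qed.

(** * Implicit functions *)

Lemma MVT_is_derive (h dh : R -> R) u v : (forall w, is_derive h w (dh w)) ->
  exists xi, Rmin u v <= xi <= Rmax u v /\ h v - h u = dh xi * (v - u).
Proof.
  intro Hd. apply MVT_gen; intros; [apply Hd|].
  apply continuity_pt_filterlim, (@ex_derive_continuous R_AbsRing R_NormedModule).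
  eexists; apply Hd.
Qed.

Lemma between_abs_le u v w c r : Rabs (u - c) <= r -> Rabs (v - c) <= r ->
  Rmin u v <= w <= Rmax u v -> Rabs (w - c) <= r.
Proof.
  intros Hu Hv Hw. unfold Rmin, Rmax in Hw.
  destruct (Rle_dec u v); revert Hu Hv; split_Rabs; lra.
Qed.

Lemma abs_ge_of_mono (phi : R -> R) (I : R -> Prop) m : 0 <= m ->
  (forall t t', I t -> I t' -> t <= t' -> m * (t' - t) <= phi t' - phi t) ->
  forall t t', I t -> I t' -> m * Rabs (t - t') <= Rabs (phi t - phi t').
Proof.
  intros Hm Hmono t t' Ht Ht'. destruct (Rle_dec t t').
  - pose proof (Hmono t t' Ht Ht' r).
    rewrite Rabs_minus_sym, (Rabs_minus_sym (phi t)), (Rabs_pos_eq (t' - t)) by lra.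
    eapply Rle_trans; [eassumption | apply Rle_abs].
  - pose proof (Hmono t' t Ht' Ht ltac:(lra)).
    rewrite (Rabs_pos_eq (t - t')) by lra.
    eapply Rle_trans; [eassumption | apply Rle_abs].
Qed.

Definition clamp (lo hi u : R) : R := Rmax lo (Rmin hi u).

Lemma clamp_in lo hi u : lo <= hi -> lo <= clamp lo hi u <= hi.
Proof. intro H. unfold clamp, Rmax, Rmin. repeat destruct Rle_dec; lra. Qed.

Lemma clamp_id lo hi u : lo <= u <= hi -> clamp lo hi u = u.
Proof. intro H. unfold clamp, Rmax, Rmin. repeat destruct Rle_dec; lra. Qed.

Lemma clamp_lip lo hi u v : lo <= hi -> Rabs (clamp lo hi u - clamp lo hi v) <= Rabs (u - v).
Proof. intro H. unfold clamp, Rmax, Rmin. repeat destruct Rle_dec; split_Rabs; lra. Qed.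

(* Composing with [clamp] extends [f] to a continuous function on all of R. *)
Lemma IVT_lipschitz (f : R -> R) lo hi K : lo <= hi -> 0 <= K ->
  (forall u v, lo <= u <= hi -> lo <= v <= hi -> Rabs (f u - f v) <= K * Rabs (u - v)) ->
  f lo <= 0 <= f hi -> exists z, lo <= z <= hi /\ f z = 0.
Proof.
  intros Hlh HK Hf Hsign. set (g := fun u => f (clamp lo hi u)).
  assert (Hg : continuity g).
  { intro u. apply continuity_pt_filterlim. apply (lipschitz_continuous g K HK). intros v w.
    eapply Rle_trans; [apply Hf; apply clamp_in; exact Hlh|].
    apply Rmult_le_compat_l; [exact HK | apply clamp_lip, Hlh]. }
  destruct (IVT_gen g lo hi 0 Hg) as [z [Hz Ez]].
  { unfold g. rewrite !clamp_id by lra. unfold Rmin, Rmax; destruct Rle_dec; lra. }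
  rewrite Rmin_left, Rmax_right in Hz by lra.
  exists z. split; [exact Hz|]. unfold g in Ez. now rewrite clamp_id in Ez.
Qed.

Lemma lipschitz_family_root (X : Type) (D : X -> Prop) (Phi : X -> R -> R) t0 r K :
  0 <= r -> 0 <= K ->
  (forall x t t', D x -> Rabs (t - t0) <= r -> Rabs (t' - t0) <= r ->
     Rabs (Phi x t - Phi x t') <= K * Rabs (t - t')) ->
  (forall x, D x -> Phi x (t0 - r) <= 0 <= Phi x (t0 + r)) ->
  exists Q : X -> R, forall x, D x -> Rabs (Q x - t0) <= r /\ Phi x (Q x) = 0.
Proof.
  intros Hr HK Hlip Hsign.
  assert (Hex : forall x, exists z, D x -> Rabs (z - t0) <= r /\ Phi x z = 0).
  { intro x. destruct (classic (D x)) as [Hx|Hx]; [|exists t0; tauto].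
    destruct (IVT_lipschitz (Phi x) (t0 - r) (t0 + r) K) as [z [Hz Ez]]; auto; try lra.
    - intros u v Hu Hv. apply Hlip; auto; apply Rabs_le_between'; lra.
    - exists z. intros _. split; [apply Rabs_le_between'; lra | exact Ez]. }
  exists (fun x => proj1_sig (constructive_indefinite_description _ (Hex x))).
  intro x. exact (proj2_sig (constructive_indefinite_description _ (Hex x))).
Qed.

Definition square (a : R*R) (r : R) (x : R*R) : Prop :=
  Rabs (fst x - fst a) <= r /\ Rabs (snd x - snd a) <= r.

Definition cube (a : R*R) (s0 t0 r : R) (x : R*R) (s t : R) : Prop :=
  square a r x /\ Rabs (s - s0) <= r /\ Rabs (t - t0) <= r.

Definition partials (F Fx1 Fx2 Fs Ft : R*R -> R -> R -> R) : Prop :=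
  forall x s t,
    is_derive (fun u => F (u, snd x) s t) (fst x) (Fx1 x s t) /\
    is_derive (fun u => F (fst x, u) s t) (snd x) (Fx2 x s t) /\
    is_derive (fun u => F x u t) s (Fs x s t) /\
    is_derive (fun u => F x s u) t (Ft x s t).

Definition partials_bounded (a : R*R) (s0 t0 r M : R) (Fx1 Fx2 Fs Ft : R*R -> R -> R -> R) :=
  forall x s t, cube a s0 t0 r x s t ->
    Rabs (Fx1 x s t) <= M /\ Rabs (Fx2 x s t) <= M /\ Rabs (Fs x s t) <= M /\ Rabs (Ft x s t) <= M.

Lemma square_l1_dist a r x : square a r x -> l1_dist x a <= 2 * r.
Proof. intros [H1 H2]. unfold l1_dist. lra. Qed.

Lemma MVT_abs_le (h dh : R -> R) u v c r M : (forall w, is_derive h w (dh w)) ->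
  Rabs (u - c) <= r -> Rabs (v - c) <= r -> (forall w, Rabs (w - c) <= r -> Rabs (dh w) <= M) ->
  Rabs (h v - h u) <= M * Rabs (v - u).
Proof.
  intros Hd Hu Hv HM. destruct (MVT_is_derive h dh u v Hd) as [xi [Hxi ->]].
  rewrite Rabs_mult. apply Rmult_le_compat_r; [apply Rabs_pos|].
  apply HM, (between_abs_le u v); assumption.
Qed.

Section Partials.

Variables (F Fx1 Fx2 Fs Ft : R*R -> R -> R -> R) (a : R*R) (s0 t0 rho : R).
Hypothesis HF : partials F Fx1 Fx2 Fs Ft.

Lemma cube_MVT_s x t s s' : cube a s0 t0 rho x s t -> cube a s0 t0 rho x s' t ->
  exists s1, cube a s0 t0 rho x s1 t /\ F x s' t - F x s t = Fs x s1 t * (s' - s).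
Proof.
  intros [Hx [Hs Ht]] [_ [Hs' _]].
  destruct (MVT_is_derive (fun u => F x u t) (fun u => Fs x u t) s s') as [s1 [Hs1 E]].
  { intro w. apply (HF x w t). }
  exists s1. split; [exact (conj Hx (conj (between_abs_le s s' s1 s0 rho Hs Hs' Hs1) Ht)) | exact E].
Qed.

Lemma cube_MVT_t x s t t' : cube a s0 t0 rho x s t -> cube a s0 t0 rho x s t' ->
  exists t1, cube a s0 t0 rho x s t1 /\ F x s t' - F x s t = Ft x s t1 * (t' - t).
Proof.
  intros [Hx [Hs Ht]] [_ [_ Ht']].
  destruct (MVT_is_derive (fun u => F x s u) (fun u => Ft x s u) t t') as [t1 [Ht1 E]].
  { intro w. apply (HF x s w). }
  exists t1. split; [exact (conj Hx (conj Hs (between_abs_le t t' t1 t0 rho Ht Ht' Ht1))) | exact E].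
Qed.

Variable M : R.
Hypothesis HFb : partials_bounded a s0 t0 rho M Fx1 Fx2 Fs Ft.

(* Move one coordinate at a time; every intermediate point stays in the cube. *)
Lemma cube_lipschitz x s t x' s' t' :
  cube a s0 t0 rho x s t -> cube a s0 t0 rho x' s' t' ->
  Rabs (F x s t - F x' s' t') <= M * (l1_dist x x' + Rabs (s - s') + Rabs (t - t')).
Proof.
  destruct x as [x1 x2], x' as [x1' x2'].
  intros [[C1 C2] [C3 C4]] [[C1' C2'] [C3' C4']]; simpl in *.
  assert (E1 : Rabs (F (x1, x2) s t - F (x1', x2) s t) <= M * Rabs (x1 - x1')).
  { apply (MVT_abs_le (fun u => F (u, x2) s t) (fun u => Fx1 (u, x2) s t) _ _ (fst a) rho);
      auto; [intro w; apply (HF (w, x2) s t) | intros w Hw; now apply (HFb (w, x2) s t)]. }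
  assert (E2 : Rabs (F (x1', x2) s t - F (x1', x2') s t) <= M * Rabs (x2 - x2')).
  { apply (MVT_abs_le (fun u => F (x1', u) s t) (fun u => Fx2 (x1', u) s t) _ _ (snd a) rho);
      auto; [intro w; apply (HF (x1', w) s t) | intros w Hw; now apply (HFb (x1', w) s t)]. }
  assert (E3 : Rabs (F (x1', x2') s t - F (x1', x2') s' t) <= M * Rabs (s - s')).
  { apply (MVT_abs_le (fun u => F (x1', x2') u t) (fun u => Fs (x1', x2') u t) _ _ s0 rho);
      auto; [intro w; apply (HF (x1', x2') w t) | intros w Hw; now apply (HFb (x1', x2') w t)]. }
  assert (E4 : Rabs (F (x1', x2') s' t - F (x1', x2') s' t') <= M * Rabs (t - t')).
  { apply (MVT_abs_le (fun u => F (x1', x2') s' u) (fun u => Ft (x1', x2') s' u) _ _ t0 rho);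
      auto; [intro w; apply (HF (x1', x2') s' w) | intros w Hw; now apply (HFb (x1', x2') s' w)]. }
  unfold l1_dist; simpl.
  pose proof (Rabs_triang (F (x1, x2) s t - F (x1', x2) s t) (F (x1', x2) s t - F (x1', x2') s t)).
  pose proof (Rabs_triang (F (x1, x2) s t - F (x1', x2') s t) (F (x1', x2') s t - F (x1', x2') s' t)).
  pose proof (Rabs_triang (F (x1, x2) s t - F (x1', x2') s' t) (F (x1', x2') s' t - F (x1', x2') s' t')).
  replace (F (x1, x2) s t - F (x1', x2) s t + (F (x1', x2) s t - F (x1', x2') s t))
    with (F (x1, x2) s t - F (x1', x2') s t) in * by ring.
  replace (F (x1, x2) s t - F (x1', x2') s t + (F (x1', x2') s t - F (x1', x2') s' t))
    with (F (x1, x2) s t - F (x1', x2') s' t) in * by ring.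
  replace (F (x1, x2) s t - F (x1', x2') s' t + (F (x1', x2') s' t - F (x1', x2') s' t'))
    with (F (x1, x2) s t - F (x1', x2') s' t') in * by ring.
  lra.
Qed.

End Partials.

Section FirstEquation.

Variables (F Fx1 Fx2 Fs Ft : R*R -> R -> R -> R) (a : R*R) (s0 t0 rho M m1 : R).
Hypotheses (HF : partials F Fx1 Fx2 Fs Ft) (HFb : partials_bounded a s0 t0 rho M Fx1 Fx2 Fs Ft).
Hypothesis HFs : forall x s t, cube a s0 t0 rho x s t -> m1 <= Fs x s t.
Hypotheses (Hrho : 0 < rho) (HM : 0 < M) (Hm1 : 0 < m1) (HF0 : F a s0 t0 = 0).

Lemma cube_mono_s x t s s' : cube a s0 t0 rho x s t -> cube a s0 t0 rho x s' t -> s <= s' ->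
  m1 * (s' - s) <= F x s' t - F x s t.
Proof.
  intros Hc Hc' Hss.
  destruct (cube_MVT_s F Fx1 Fx2 Fs Ft a s0 t0 rho HF x t s s' Hc Hc') as [s1 [Hc1 ->]].
  apply Rmult_le_compat_r; [lra | exact (HFs _ _ _ Hc1)].
Qed.

Lemma cube_abs_s x t s s' : cube a s0 t0 rho x s t -> cube a s0 t0 rho x s' t ->
  m1 * Rabs (s - s') <= Rabs (F x s t - F x s' t).
Proof.
  apply (abs_ge_of_mono (fun u => F x u t) (fun u => cube a s0 t0 rho x u t)); [lra|].
  intros; now apply cube_mono_s.
Qed.

Lemma cube_root_dist x t s x' t' s' : cube a s0 t0 rho x s t -> cube a s0 t0 rho x' s' t' ->
  F x s t = 0 -> F x' s' t' = 0 -> m1 * Rabs (s - s') <= M * (l1_dist x x' + Rabs (t - t')).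
Proof.
  intros Hc Hc' Fs0 Fs0'. pose proof Hc as [Hx [Hs Ht]]. pose proof Hc' as [Hx' [Hs' Ht']].
  assert (Hc'' : cube a s0 t0 rho x s' t) by exact (conj Hx (conj Hs' Ht)).
  eapply Rle_trans; [apply (cube_abs_s x t); assumption|].
  replace (F x s t - F x s' t) with (F x' s' t' - F x s' t) by (rewrite Fs0, Fs0'; ring).
  eapply Rle_trans; [apply (cube_lipschitz F Fx1 Fx2 Fs Ft a s0 t0 rho HF M HFb); eassumption|].
  rewrite l1_dist_sym, Rminus_diag, Rabs_R0, (Rabs_minus_sym t'). lra.
Qed.

(* Strict monotonicity in [s] at the base point, perturbed by at most [3 M r1]. *)
Lemma first_equation_sign r1 x t : r1 <= rho -> 3 * M * r1 <= m1 * rho / 2 ->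
  square a r1 x -> Rabs (t - t0) <= r1 -> F x (s0 - rho) t <= 0 <= F x (s0 + rho) t.
Proof.
  intros Hr1rho HMr1 Hx Ht.
  assert (Hcube : forall y u v, square a r1 y -> Rabs (v - t0) <= r1 -> Rabs (u - s0) <= rho ->
                    cube a s0 t0 rho y u v).
  { intros y u v [H1 H2] Hv Hu. repeat split; lra. }
  assert (Hr1 : 0 <= r1) by (pose proof (Rabs_pos (t - t0)); lra).
  assert (Ha : square a r1 a) by (split; rewrite Rminus_diag, Rabs_R0; lra).
  assert (Ht0 : Rabs (t0 - t0) <= r1) by (rewrite Rminus_diag, Rabs_R0; lra).
  assert (Hs0 : Rabs (s0 - s0) <= rho) by (rewrite Rminus_diag, Rabs_R0; lra).
  assert (Hsp : Rabs (s0 + rho - s0) <= rho) by (apply Rabs_le_between'; lra).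
  assert (Hsm : Rabs (s0 - rho - s0) <= rho) by (apply Rabs_le_between'; lra).
  assert (Hpert : forall u, Rabs (u - s0) <= rho -> Rabs (F x u t - F a u t0) <= m1 * rho / 2).
  { intros u Hu. eapply Rle_trans.
    - apply (cube_lipschitz F Fx1 Fx2 Fs Ft a s0 t0 rho HF M HFb); apply Hcube; assumption.
    - rewrite Rminus_diag, Rabs_R0. pose proof (square_l1_dist a r1 x Hx). nra. }
  pose proof (cube_mono_s a t0 s0 (s0 + rho) (Hcube _ _ _ Ha Ht0 Hs0) (Hcube _ _ _ Ha Ht0 Hsp)).
  pose proof (cube_mono_s a t0 (s0 - rho) s0 (Hcube _ _ _ Ha Ht0 Hsm) (Hcube _ _ _ Ha Ht0 Hs0)).
  pose proof (proj1 (Rabs_le_between' _ _ _) (Hpert _ Hsp)).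
  pose proof (proj1 (Rabs_le_between' _ _ _) (Hpert _ Hsm)).
  assert (0 < m1 * rho) by nra. split; nra.
Qed.

Lemma first_equation_root : exists r1 (P : R*R -> R -> R), 0 < r1 /\ r1 <= rho /\ P a t0 = s0 /\
  (forall x t, square a r1 x -> Rabs (t - t0) <= r1 ->
     Rabs (P x t - s0) <= rho /\ F x (P x t) t = 0) /\
  (forall x t x' t', square a r1 x -> Rabs (t - t0) <= r1 -> square a r1 x' -> Rabs (t' - t0) <= r1 ->
     m1 * Rabs (P x t - P x' t') <= M * (l1_dist x x' + Rabs (t - t'))).
Proof.
  set (r1 := Rmin rho (m1 * rho / (6 * M))).
  assert (Hr1 : 0 < r1) by (apply Rmin_glb_lt; [lra | apply Rdiv_lt_0_compat; nra]).
  assert (Hr1rho : r1 <= rho) by apply Rmin_l.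
  assert (HMr1 : 3 * M * r1 <= m1 * rho / 2).
  { assert (r1 <= m1 * rho / (6 * M)) by apply Rmin_r.
    replace (m1 * rho / 2) with (3 * M * (m1 * rho / (6 * M))) by (field; lra).
    apply Rmult_le_compat_l; lra. }
  assert (Hcube : forall x t s, square a r1 x -> Rabs (t - t0) <= r1 -> Rabs (s - s0) <= rho ->
                    cube a s0 t0 rho x s t).
  { intros x t s [H1 H2] Ht Hs. repeat split; lra. }
  destruct (lipschitz_family_root ((R*R)*R) (fun w => square a r1 (fst w) /\ Rabs (snd w - t0) <= r1)
              (fun w s => F (fst w) s (snd w)) s0 rho M) as [Q HQ]; try lra.
  { intros [x t] s s' [Hx Ht] Hs Hs'. simpl in *.
    eapply Rle_trans; [apply (cube_lipschitz F Fx1 Fx2 Fs Ft a s0 t0 rho HF M HFb);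
                       apply Hcube; eassumption|].
    rewrite l1_dist_refl, Rminus_diag, Rabs_R0. lra. }
  { intros [x t] [Hx Ht]. exact (first_equation_sign r1 x t Hr1rho HMr1 Hx Ht). }
  exists r1, (fun x t => Q (x, t)). split; [exact Hr1 | split; [exact Hr1rho | split; [| split]]].
  - assert (Ha : square a r1 a) by (split; rewrite Rminus_diag, Rabs_R0; lra).
    assert (Ht0 : Rabs (t0 - t0) <= r1) by (rewrite Rminus_diag, Rabs_R0; lra).
    destruct (HQ (a, t0) (conj Ha Ht0)) as [Hp Fp]. simpl in Hp, Fp.
    pose proof (cube_root_dist a t0 (Q (a, t0)) a t0 s0 (Hcube _ _ _ Ha Ht0 Hp)) as Hd.
    rewrite l1_dist_refl, Rminus_diag, Rabs_R0, Rplus_0_r, Rmult_0_r in Hd.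
    assert (Rabs (Q (a, t0) - s0) = 0).
    { pose proof (Rabs_pos (Q (a, t0) - s0)).
      enough (m1 * Rabs (Q (a, t0) - s0) <= 0) by nra.
      apply Hd; auto. apply Hcube; auto. rewrite Rminus_diag, Rabs_R0; lra. }
    apply Rabs_eq_0 in H. lra.
  - intros x t Hx Ht. exact (HQ (x, t) (conj Hx Ht)).
  - intros x t x' t' Hx Ht Hx' Ht'.
    destruct (HQ (x, t) (conj Hx Ht)) as [Hp Fp]. destruct (HQ (x', t') (conj Hx' Ht')) as [Hp' Fp'].
    apply cube_root_dist; auto.
Qed.

End FirstEquation.

Definition jacobian_lower_bound (a : R*R) (s0 t0 r m : R) (Fs Ft Gs Gt : R*R -> R -> R -> R) :=
  forall x s1 t1 s2 t2 s3 t3 s4 t4,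
    cube a s0 t0 r x s1 t1 -> cube a s0 t0 r x s2 t2 ->
    cube a s0 t0 r x s3 t3 -> cube a s0 t0 r x s4 t4 ->
    m <= Fs x s1 t1 * Gt x s4 t4 - Gs x s3 t3 * Ft x s2 t2.

Section SecondEquation.

Variables (F Fx1 Fx2 Fs Ft G Gx1 Gx2 Gs Gt : R*R -> R -> R -> R) (a : R*R) (s0 t0 rho M m1 m2 : R).
Hypotheses (HF : partials F Fx1 Fx2 Fs Ft) (HFb : partials_bounded a s0 t0 rho M Fx1 Fx2 Fs Ft).
Hypotheses (HG : partials G Gx1 Gx2 Gs Gt) (HGb : partials_bounded a s0 t0 rho M Gx1 Gx2 Gs Gt).
Hypotheses (HM : 0 < M) (Hm1 : 0 < m1) (Hm2 : 0 < m2) (HG0 : G a s0 t0 = 0).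
Hypothesis HFs : forall x s t, cube a s0 t0 rho x s t -> m1 <= Fs x s t.
Hypothesis Hjac : jacobian_lower_bound a s0 t0 rho m2 Fs Ft Gs Gt.

Variables (r1 : R) (P : R*R -> R -> R).
Hypotheses (Hr1 : 0 < r1) (Hr1rho : r1 <= rho) (HPa : P a t0 = s0).
Hypothesis HP : forall x t, square a r1 x -> Rabs (t - t0) <= r1 ->
  Rabs (P x t - s0) <= rho /\ F x (P x t) t = 0.
Hypothesis HPlip : forall x t x' t', square a r1 x -> Rabs (t - t0) <= r1 ->
  square a r1 x' -> Rabs (t' - t0) <= r1 ->
  m1 * Rabs (P x t - P x' t') <= M * (l1_dist x x' + Rabs (t - t')).

Let Phi x t := G x (P x t) t.

Let cube_P x t : square a r1 x -> Rabs (t - t0) <= r1 -> cube a s0 t0 rho x (P x t) t.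
Proof. intros [H1 H2] Ht. repeat split; try lra. apply (HP x t); [split|]; assumption. Qed.

(* Along the curve F = 0, the implicit derivative of Phi is the Jacobian divided by Fs. *)
Lemma reduced_mono x t t' : square a r1 x -> Rabs (t - t0) <= r1 -> Rabs (t' - t0) <= r1 ->
  t <= t' -> m2 / M * (t' - t) <= Phi x t' - Phi x t.
Proof.
  intros Hx Ht Ht' Htt. unfold Phi.
  destruct (HP x t Hx Ht) as [_ Fp]. destruct (HP x t' Hx Ht') as [_ Fp'].
  pose proof (cube_P x t Hx Ht) as C. pose proof (cube_P x t' Hx Ht') as C'.
  set (p := P x t) in *. set (p' := P x t') in *.
  assert (C'' : cube a s0 t0 rho x p t') by (destruct C as [Cx [Cp _]], C' as [_ [_ Ct']]; exact (conj Cx (conj Cp Ct'))).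
  destruct (cube_MVT_s F Fx1 Fx2 Fs Ft a s0 t0 rho HF x t' p p' C'' C') as [s1 [C1 E1]].
  destruct (cube_MVT_t F Fx1 Fx2 Fs Ft a s0 t0 rho HF x p t t' C C'') as [t2 [C2 E2]].
  destruct (cube_MVT_s G Gx1 Gx2 Gs Gt a s0 t0 rho HG x t' p p' C'' C') as [s3 [C3 E3]].
  destruct (cube_MVT_t G Gx1 Gx2 Gs Gt a s0 t0 rho HG x p t t' C C'') as [t4 [C4 E4]].
  pose proof (Hjac x s1 t' p t2 s3 t' p t4 C1 C2 C3 C4) as Hdet.
  pose proof (HFs x s1 t' C1) as HA. pose proof (HFb x s1 t' C1) as [_ [_ [HAM _]]].
  apply Rabs_le_between in HAM.
  set (A := Fs x s1 t') in *. set (B := Ft x p t2) in *.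
  set (C3' := Gs x s3 t') in *. set (E := Gt x p t4) in *.
  assert (HPhi : A * (G x p' t' - G x p t) = (t' - t) * (A * E - C3' * B)).
  { replace (G x p' t' - G x p t) with ((G x p' t' - G x p t') + (G x p t' - G x p t)) by ring.
    rewrite E3, E4.
    assert (Z : A * (p' - p) + B * (t' - t) = 0).
    { rewrite <- E1, <- E2. replace (F x p' t' - F x p t' + (F x p t' - F x p t))
        with (F x p' t' - F x p t) by ring. rewrite Fp, Fp'. ring. }
    replace (A * (C3' * (p' - p) + E * (t' - t)))
      with (C3' * (A * (p' - p) + B * (t' - t)) + (t' - t) * (A * E - C3' * B)) by ring.
    rewrite Z. ring. }
  assert (Hlow : (t' - t) * m2 <= A * (G x p' t' - G x p t))
    by (rewrite HPhi; apply Rmult_le_compat_l; lra).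
  apply (Rmult_le_reg_l M); [exact HM|].
  replace (M * (m2 / M * (t' - t))) with ((t' - t) * m2) by (field; lra).
  assert (0 <= (t' - t) * m2) by (apply Rmult_le_pos; lra).
  destruct (Rle_dec 0 (G x p' t' - G x p t)); nra.
Qed.

Lemma reduced_lipschitz x t x' t' : square a r1 x -> Rabs (t - t0) <= r1 ->
  square a r1 x' -> Rabs (t' - t0) <= r1 ->
  Rabs (Phi x t - Phi x' t') <= M * (1 + M / m1) * (l1_dist x x' + Rabs (t - t')).
Proof.
  intros Hx Ht Hx' Ht'. unfold Phi.
  eapply Rle_trans; [apply (cube_lipschitz G Gx1 Gx2 Gs Gt a s0 t0 rho HG M HGb); apply cube_P; assumption|].
  pose proof (HPlip x t x' t' Hx Ht Hx' Ht') as HL.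
  assert (Rabs (P x t - P x' t') <= M / m1 * (l1_dist x x' + Rabs (t - t'))).
  { apply (Rmult_le_reg_l m1); [exact Hm1|].
    replace (m1 * (M / m1 * (l1_dist x x' + Rabs (t - t')))) with (M * (l1_dist x x' + Rabs (t - t')))
      by (field; lra). exact HL. }
  pose proof (l1_dist_nonneg x x').
  pose proof (Rabs_pos (t - t')). nra.
Qed.

Lemma reduced_sign r2 x : r2 <= r1 -> 2 * (M * (1 + M / m1)) * r2 <= m2 / M * r1 / 2 ->
  square a r2 x -> Phi x (t0 - r1) <= 0 <= Phi x (t0 + r1).
Proof.
  intros Hr2r1 Hr2 Hx.
  assert (Hx1 : square a r1 x) by (destruct Hx; split; lra).
  assert (Ha : square a r1 a) by (split; rewrite Rminus_diag, Rabs_R0; lra).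
  assert (Ht0 : Rabs (t0 - t0) <= r1) by (rewrite Rminus_diag, Rabs_R0; lra).
  assert (Htp : Rabs (t0 + r1 - t0) <= r1) by (apply Rabs_le_between'; lra).
  assert (Htm : Rabs (t0 - r1 - t0) <= r1) by (apply Rabs_le_between'; lra).
  assert (HPhi0 : Phi a t0 = 0) by (unfold Phi; rewrite HPa; exact HG0).
  pose proof (reduced_mono a t0 (t0 + r1) Ha Ht0 Htp ltac:(lra)).
  pose proof (reduced_mono a (t0 - r1) t0 Ha Htm Ht0 ltac:(lra)).
  pose proof (square_l1_dist a r2 x Hx).
  pose proof (reduced_lipschitz x (t0 + r1) a (t0 + r1) Hx1 Htp Ha Htp) as Lp.
  pose proof (reduced_lipschitz x (t0 - r1) a (t0 - r1) Hx1 Htm Ha Htm) as Lm.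
  rewrite Rminus_diag, Rabs_R0, Rplus_0_r in Lp, Lm.
  apply Rabs_le_between' in Lp, Lm.
  assert (0 <= M * (1 + M / m1)) by (apply Rmult_le_pos; [lra|]; pose proof (Rdiv_lt_0_compat M m1 HM Hm1); lra).
  assert (M * (1 + M / m1) * l1_dist x a <= m2 / M * r1 / 2) by nra.
  assert (0 < m2 / M * r1) by (apply Rmult_lt_0_compat; [apply Rdiv_lt_0_compat|]; lra).
  replace (t0 + r1 - t0) with r1 in * by ring. replace (t0 - (t0 - r1)) with r1 in * by ring.
  split; lra.
Qed.

Lemma second_equation_root : exists r2 (Q : R*R -> R), 0 < r2 /\ r2 <= r1 /\
  (forall x, square a r2 x -> Rabs (Q x - t0) <= r1 /\ Phi x (Q x) = 0) /\
  (forall x x', square a r2 x -> square a r2 x' ->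
     m2 / M * Rabs (Q x - Q x') <= M * (1 + M / m1) * l1_dist x x').
Proof.
  set (K := M * (1 + M / m1)). set (m3 := m2 / M).
  assert (HK : 0 < K) by (apply Rmult_lt_0_compat; [lra|]; pose proof (Rdiv_lt_0_compat M m1 HM Hm1); lra).
  assert (Hm3 : 0 < m3) by (apply Rdiv_lt_0_compat; lra).
  set (r2 := Rmin r1 (m3 * r1 / (4 * K))).
  assert (Hr2 : 0 < r2) by (apply Rmin_glb_lt; [lra | apply Rdiv_lt_0_compat; nra]).
  assert (Hr2r1 : r2 <= r1) by apply Rmin_l.
  assert (HKr2 : 2 * K * r2 <= m3 * r1 / 2).
  { assert (r2 <= m3 * r1 / (4 * K)) by apply Rmin_r.
    replace (m3 * r1 / 2) with (2 * K * (m3 * r1 / (4 * K))) by (field; lra).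
    apply Rmult_le_compat_l; lra. }
  assert (Hsq : forall x, square a r2 x -> square a r1 x) by (intros x [H1 H2]; split; lra).
  destruct (lipschitz_family_root (R*R) (square a r2) Phi t0 r1 K) as [Q HQ]; try lra.
  { intros x t t' Hx Ht Ht'. eapply Rle_trans; [apply reduced_lipschitz; auto|].
    rewrite l1_dist_refl, Rplus_0_l. unfold K. lra. }
  { intros x Hx. exact (reduced_sign r2 x Hr2r1 HKr2 Hx). }
  exists r2, Q. split; [exact Hr2 | split; [exact Hr2r1 | split; [exact HQ|]]].
  intros x x' Hx Hx'. destruct (HQ x Hx) as [Hq Fq]. destruct (HQ x' Hx') as [Hq' Fq'].
  eapply Rle_trans.
  - apply (abs_ge_of_mono (Phi x) (fun t => Rabs (t - t0) <= r1)); auto; [lra|].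
    intros; apply reduced_mono; auto.
  - replace (Phi x (Q x) - Phi x (Q x')) with (Phi x' (Q x') - Phi x (Q x')) by (rewrite Fq, Fq'; ring).
    eapply Rle_trans; [apply reduced_lipschitz; auto|].
    rewrite Rminus_diag, Rabs_R0, Rplus_0_r, l1_dist_sym. unfold K. lra.
Qed.

End SecondEquation.

Definition lip2_on (D : R*R -> Prop) (h : R*R -> R) (L : R) : Prop :=
  forall z z', D z -> D z' -> Rabs (h z - h z') <= L * l1_dist z z'.

Definition implicit_solution (F G : R*R -> R -> R -> R) (a : R*R) (s0 t0 : R) : Prop :=
  exists r d L (S Q : R*R -> R), 0 < r /\ 0 < d /\ 0 <= L /\
    (forall x, square a r x -> Rabs (S x - s0) <= d /\ Rabs (Q x - t0) <= d /\
                                F x (S x) (Q x) = 0 /\ G x (S x) (Q x) = 0) /\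
    lip2_on (square a r) S L /\ lip2_on (square a r) Q L.

(* Solve F = 0 for s as s = P(x, t), then G(x, P(x, t), t) = 0 for t as t = Q(x). *)
Lemma implicit_solution_of_bounds F Fx1 Fx2 Fs Ft G Gx1 Gx2 Gs Gt a s0 t0 rho M m1 m2 :
  partials F Fx1 Fx2 Fs Ft -> partials_bounded a s0 t0 rho M Fx1 Fx2 Fs Ft ->
  partials G Gx1 Gx2 Gs Gt -> partials_bounded a s0 t0 rho M Gx1 Gx2 Gs Gt ->
  0 < rho -> 0 < M -> 0 < m1 -> 0 < m2 ->
  (forall x s t, cube a s0 t0 rho x s t -> m1 <= Fs x s t) ->
  jacobian_lower_bound a s0 t0 rho m2 Fs Ft Gs Gt ->
  F a s0 t0 = 0 -> G a s0 t0 = 0 -> implicit_solution F G a s0 t0.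
Proof.
  intros HF HFb HG HGb Hrho HM Hm1 Hm2 HFs Hjac HF0 HG0.
  destruct (first_equation_root F Fx1 Fx2 Fs Ft a s0 t0 rho M m1 HF HFb HFs Hrho HM Hm1 HF0)
    as [r1 [P [Hr1 [Hr1rho [HPa [HP HPlip]]]]]].
  destruct (second_equation_root F Fx1 Fx2 Fs Ft G Gx1 Gx2 Gs Gt a s0 t0 rho M m1 m2
              HF HFb HG HGb HM Hm1 Hm2 HG0 HFs Hjac r1 P Hr1 Hr1rho HPa HP HPlip)
    as [r2 [Q [Hr2 [Hr2r1 [HQ HQlip]]]]].
  set (LQ := M * (1 + M / m1) / (m2 / M)).
  assert (HLQ : 0 <= LQ).
  { pose proof (Rdiv_lt_0_compat M m1 HM Hm1). pose proof (Rdiv_lt_0_compat m2 M Hm2 HM).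
    unfold LQ. apply Rlt_le, Rdiv_lt_0_compat; [apply Rmult_lt_0_compat|]; lra. }
  assert (HsqQ : forall x, square a r2 x -> square a r1 x /\ Rabs (Q x - t0) <= r1).
  { intros x [H1 H2]. split; [split; lra | apply HQ; split; assumption]. }
  assert (HQL : lip2_on (square a r2) Q LQ).
  { intros x x' Hx Hx'. pose proof (HQlip x x' Hx Hx').
    apply (Rmult_le_reg_l (m2 / M)); [apply Rdiv_lt_0_compat; lra|].
    unfold LQ. replace (m2 / M * (M * (1 + M / m1) / (m2 / M) * l1_dist x x'))
      with (M * (1 + M / m1) * l1_dist x x') by (field; lra). assumption. }
  set (L := LQ + M / m1 * (1 + LQ)).
  assert (HLQL : LQ <= L).
  { pose proof (Rdiv_lt_0_compat M m1 HM Hm1). unfold L. nra. }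
  exists r2, rho, L, (fun x => P x (Q x)), Q.
  split; [exact Hr2 | split; [exact Hrho | split; [lra | split; [| split]]]].
  - intros x Hx. destruct (HsqQ x Hx) as [Hx1 Hq].
    destruct (HP x (Q x) Hx1 Hq) as [Hp Fp]. destruct (HQ x Hx) as [_ Gq].
    repeat split; auto. lra.
  - intros x x' Hx Hx'. destruct (HsqQ x Hx) as [Hx1 Hq]. destruct (HsqQ x' Hx') as [Hx1' Hq'].
    pose proof (HPlip x (Q x) x' (Q x') Hx1 Hq Hx1' Hq') as HS. pose proof (HQL x x' Hx Hx').
    apply (Rmult_le_reg_l m1); [exact Hm1|]. eapply Rle_trans; [exact HS|].
    pose proof (l1_dist_nonneg x x'). unfold L.
    replace (m1 * ((LQ + M / m1 * (1 + LQ)) * l1_dist x x'))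
      with (m1 * LQ * l1_dist x x' + M * (l1_dist x x' + LQ * l1_dist x x')) by (field; lra).
    assert (0 <= m1 * LQ * l1_dist x x') by (apply Rmult_le_pos; [apply Rmult_le_pos|]; lra).
    nra.
  - intros x x' Hx Hx'. eapply Rle_trans; [apply HQL; assumption|].
    apply Rmult_le_compat_r; [apply l1_dist_nonneg | exact HLQL].
Qed.

Definition near_base (a : R*R) (s0 t0 : R) (P : R*R -> R -> R -> Prop) : Prop :=
  exists del, 0 < del /\ forall x s t, cube a s0 t0 del x s t -> P x s t.

Lemma near_base_and a s0 t0 P Q : near_base a s0 t0 P -> near_base a s0 t0 Q ->
  near_base a s0 t0 (fun x s t => P x s t /\ Q x s t).
Proof.
  intros [d1 [Hd1 HP]] [d2 [Hd2 HQ]]. exists (Rmin d1 d2). split; [now apply Rmin_glb_lt|].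
  pose proof (Rmin_l d1 d2). pose proof (Rmin_r d1 d2).
  intros x s t [[H1 H2] [H3 H4]]. split; [apply HP | apply HQ]; repeat split; lra.
Qed.

Definition cont_base (a : R*R) (s0 t0 : R) (D : R*R -> R -> R -> R) : Prop :=
  forall eps, 0 < eps -> near_base a s0 t0 (fun x s t => Rabs (D x s t - D a s0 t0) < eps).

Definition partials_cont (a : R*R) (s0 t0 : R) (Fx1 Fx2 Fs Ft : R*R -> R -> R -> R) : Prop :=
  cont_base a s0 t0 Fx1 /\ cont_base a s0 t0 Fx2 /\ cont_base a s0 t0 Fs /\ cont_base a s0 t0 Ft.

Definition partials_close (a : R*R) (s0 t0 eps : R) (Fx1 Fx2 Fs Ft : R*R -> R -> R -> R)
  (x : R*R) (s t : R) : Prop :=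
  Rabs (Fx1 x s t - Fx1 a s0 t0) < eps /\ Rabs (Fx2 x s t - Fx2 a s0 t0) < eps /\
  Rabs (Fs x s t - Fs a s0 t0) < eps /\ Rabs (Ft x s t - Ft a s0 t0) < eps.

Lemma partials_cont_near a s0 t0 Fx1 Fx2 Fs Ft eps :
  partials_cont a s0 t0 Fx1 Fx2 Fs Ft -> 0 < eps ->
  near_base a s0 t0 (partials_close a s0 t0 eps Fx1 Fx2 Fs Ft).
Proof.
  intros [C1 [C2 [C3 C4]]] Heps.
  repeat apply near_base_and; [apply C1 | apply C2 | apply C3 | apply C4]; exact Heps.
Qed.

Lemma partials_bounded_of_close a s0 t0 rho eps M Fx1 Fx2 Fs Ft : eps <= 1 ->
  1 + (Rabs (Fx1 a s0 t0) + Rabs (Fx2 a s0 t0) + Rabs (Fs a s0 t0) + Rabs (Ft a s0 t0)) <= M ->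
  (forall x s t, cube a s0 t0 rho x s t -> partials_close a s0 t0 eps Fx1 Fx2 Fs Ft x s t) ->
  partials_bounded a s0 t0 rho M Fx1 Fx2 Fs Ft.
Proof.
  intros Heps HM Hclose x s t Hc. destruct (Hclose x s t Hc) as [N1 [N2 [N3 N4]]].
  pose proof (Rabs_triang_inv (Fx1 x s t) (Fx1 a s0 t0)).
  pose proof (Rabs_triang_inv (Fx2 x s t) (Fx2 a s0 t0)).
  pose proof (Rabs_triang_inv (Fs x s t) (Fs a s0 t0)).
  pose proof (Rabs_triang_inv (Ft x s t) (Ft a s0 t0)).
  pose proof (Rabs_pos (Fx1 a s0 t0)). pose proof (Rabs_pos (Fx2 a s0 t0)).
  pose proof (Rabs_pos (Fs a s0 t0)). pose proof (Rabs_pos (Ft a s0 t0)).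
  repeat split; lra.
Qed.

Lemma det_perturbation a1 A e4 E c3 C b2 B eta :
  0 <= eta <= 1 -> 0 <= A -> Rabs (a1 - A) <= eta -> Rabs (e4 - E) <= eta ->
  Rabs (c3 - C) <= eta -> Rabs (b2 - B) <= eta ->
  (A * E - C * B) - eta * (2 + A + Rabs B + Rabs C + Rabs E) <= a1 * e4 - c3 * b2.
Proof.
  intros He HA H1 H4 H3 H2.
  assert (Rabs e4 <= Rabs E + 1) by (pose proof (Rabs_triang_inv e4 E); lra).
  assert (Rabs c3 <= Rabs C + 1) by (pose proof (Rabs_triang_inv c3 C); lra).
  assert (X1 : Rabs ((a1 - A) * e4) <= eta * (Rabs E + 1))
    by (rewrite Rabs_mult; apply Rmult_le_compat; auto; apply Rabs_pos).
  assert (X2 : Rabs (A * (e4 - E)) <= A * eta)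
    by (rewrite Rabs_mult, Rabs_pos_eq by auto; apply Rmult_le_compat_l; auto).
  assert (X3 : Rabs (c3 * (b2 - B)) <= (Rabs C + 1) * eta)
    by (rewrite Rabs_mult; apply Rmult_le_compat; auto; apply Rabs_pos).
  assert (X4 : Rabs ((c3 - C) * B) <= eta * Rabs B)
    by (rewrite Rabs_mult; apply Rmult_le_compat_r; auto; apply Rabs_pos).
  apply Rabs_le_between in X1, X2, X3, X4.
  replace (a1 * e4 - c3 * b2) with
    ((A * E - C * B) + (a1 - A) * e4 + A * (e4 - E) - c3 * (b2 - B) - (c3 - C) * B) by ring.
  lra.
Qed.

(* Continuity at the base point yields a cube on which the partials are bounded by [M],
   [Fs >= Fs(base) / 2] and the Jacobian stays above [det(base) / 2]. *)
Lemma implicit_solution_of_continuity F Fx1 Fx2 Fs Ft G Gx1 Gx2 Gs Gt a s0 t0 :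
  partials F Fx1 Fx2 Fs Ft -> partials G Gx1 Gx2 Gs Gt ->
  partials_cont a s0 t0 Fx1 Fx2 Fs Ft -> partials_cont a s0 t0 Gx1 Gx2 Gs Gt ->
  0 < Fs a s0 t0 -> 0 < Fs a s0 t0 * Gt a s0 t0 - Gs a s0 t0 * Ft a s0 t0 ->
  F a s0 t0 = 0 -> G a s0 t0 = 0 -> implicit_solution F G a s0 t0.
Proof.
  intros HF HG HFc HGc HA Hdet HF0 HG0.
  set (A := Fs a s0 t0) in *. set (B := Ft a s0 t0) in *.
  set (C := Gs a s0 t0) in *. set (E := Gt a s0 t0) in *.
  set (det := A * E - C * B) in *.
  set (K := 2 + A + Rabs B + Rabs C + Rabs E).
  assert (HK : 0 < K) by (unfold K; pose proof (Rabs_pos B); pose proof (Rabs_pos C);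
                          pose proof (Rabs_pos E); lra).
  assert (Hq : 0 < det / (2 * K)) by (apply Rdiv_lt_0_compat; lra).
  set (eta := Rmin 1 (Rmin (A / 2) (det / (2 * K)))).
  assert (He1 : eta <= 1) by apply Rmin_l.
  assert (He2 : eta <= A / 2) by (eapply Rle_trans; [apply Rmin_r | apply Rmin_l]).
  assert (He3 : eta <= det / (2 * K)) by (eapply Rle_trans; [apply Rmin_r | apply Rmin_r]).
  assert (He : 0 < eta) by (apply Rmin_glb_lt; [lra | apply Rmin_glb_lt; lra]).
  destruct (near_base_and _ _ _ _ _ (partials_cont_near _ _ _ _ _ _ _ _ HFc He)
                                    (partials_cont_near _ _ _ _ _ _ _ _ HGc He))
    as [rho [Hrho Hnear]].
  set (M := 1 + (Rabs (Fx1 a s0 t0) + Rabs (Fx2 a s0 t0) + Rabs A + Rabs B)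
              + (Rabs (Gx1 a s0 t0) + Rabs (Gx2 a s0 t0) + Rabs C + Rabs E)).
  pose proof (Rabs_pos (Fx1 a s0 t0)). pose proof (Rabs_pos (Fx2 a s0 t0)).
  pose proof (Rabs_pos (Gx1 a s0 t0)). pose proof (Rabs_pos (Gx2 a s0 t0)).
  pose proof (Rabs_pos A). pose proof (Rabs_pos B). pose proof (Rabs_pos C). pose proof (Rabs_pos E).
  apply (implicit_solution_of_bounds F Fx1 Fx2 Fs Ft G Gx1 Gx2 Gs Gt a s0 t0 rho M (A / 2) (det / 2));
    auto; try (unfold M; lra).
  - apply (partials_bounded_of_close _ _ _ _ eta); [lra | unfold M; fold (A) (B); lra |].
    intros x s t Hc. exact (proj1 (Hnear x s t Hc)).
  - apply (partials_bounded_of_close _ _ _ _ eta); [lra | unfold M; fold (C) (E); lra |].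
    intros x s t Hc. exact (proj2 (Hnear x s t Hc)).
  - intros x s t Hc. destruct (Hnear x s t Hc) as [[_ [_ [N _]]] _].
    apply Rabs_lt_between' in N. fold A in N. lra.
  - intros x s1 t1 s2 t2 s3 t3 s4 t4 C1 C2 C3 C4.
    destruct (Hnear x s1 t1 C1) as [[_ [_ [X1 _]]] _].
    destruct (Hnear x s2 t2 C2) as [[_ [_ [_ X2]]] _].
    destruct (Hnear x s3 t3 C3) as [_ [_ [_ [X3 _]]]].
    destruct (Hnear x s4 t4 C4) as [_ [_ [_ [_ X4]]]].
    fold (A) (B) (C) (E) in X1, X2, X3, X4.
    pose proof (det_perturbation (Fs x s1 t1) A (Gt x s4 t4) E (Gs x s3 t3) C (Ft x s2 t2) B eta
                 ltac:(lra) ltac:(lra) ltac:(lra) ltac:(lra) ltac:(lra) ltac:(lra)) as Y.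
    fold det K in Y.
    assert (eta * K <= det / 2).
    { replace (det / 2) with (det / (2 * K) * K) by (field; lra). apply Rmult_le_compat_r; lra. }
    lra.
Qed.

Definition opp3 (F : R*R -> R -> R -> R) : R*R -> R -> R -> R := fun x s t => - F x s t.

Lemma partials_opp F Fx1 Fx2 Fs Ft : partials F Fx1 Fx2 Fs Ft ->
  partials (opp3 F) (opp3 Fx1) (opp3 Fx2) (opp3 Fs) (opp3 Ft).
Proof.
  intros HF x s t. destruct (HF x s t) as [D1 [D2 [D3 D4]]]. unfold opp3.
  exact (conj (is_derive_opp _ _ _ D1) (conj (is_derive_opp _ _ _ D2)
           (conj (is_derive_opp _ _ _ D3) (is_derive_opp _ _ _ D4)))).
Qed.

Lemma partials_cont_opp a s0 t0 Fx1 Fx2 Fs Ft : partials_cont a s0 t0 Fx1 Fx2 Fs Ft ->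
  partials_cont a s0 t0 (opp3 Fx1) (opp3 Fx2) (opp3 Fs) (opp3 Ft).
Proof.
  assert (Hopp : forall D, cont_base a s0 t0 D -> cont_base a s0 t0 (opp3 D)).
  { intros D HD eps Heps. destruct (HD eps Heps) as [del [Hdel Hnear]].
    exists del. split; [exact Hdel|]. intros x s t Hc. unfold opp3.
    rewrite <- Rabs_Ropp. replace (- (- D x s t - - D a s0 t0)) with (D x s t - D a s0 t0) by ring.
    now apply Hnear. }
  intros [C1 [C2 [C3 C4]]]. repeat split; apply Hopp; assumption.
Qed.

Lemma implicit_solution_zeros F G F' G' a s0 t0 :
  (forall x s t, F' x s t = 0 -> F x s t = 0) -> (forall x s t, G' x s t = 0 -> G x s t = 0) ->
  implicit_solution F' G' a s0 t0 -> implicit_solution F G a s0 t0.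
Proof.
  intros HFF HGG [r [d [L [S [Q [Hr [Hd [HL [HSQ HLip]]]]]]]]].
  exists r, d, L, S, Q. split; [exact Hr | split; [exact Hd | split; [exact HL | split; [| exact HLip]]]].
  intros x Hx. destruct (HSQ x Hx) as [H1 [H2 [H3 H4]]]. repeat split; auto.
Qed.

(* Reduce to [Fs > 0] and a positive Jacobian by replacing [F] or [G] with its opposite. *)
Lemma implicit_solution_of_nonzero F Fx1 Fx2 Fs Ft G Gx1 Gx2 Gs Gt a s0 t0 :
  partials F Fx1 Fx2 Fs Ft -> partials G Gx1 Gx2 Gs Gt ->
  partials_cont a s0 t0 Fx1 Fx2 Fs Ft -> partials_cont a s0 t0 Gx1 Gx2 Gs Gt ->
  Fs a s0 t0 <> 0 -> Fs a s0 t0 * Gt a s0 t0 - Gs a s0 t0 * Ft a s0 t0 <> 0 ->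
  F a s0 t0 = 0 -> G a s0 t0 = 0 -> implicit_solution F G a s0 t0.
Proof.
  intros HF HG HFc HGc HA Hdet HF0 HG0.
  assert (Hopp0 : forall D x s t, opp3 D x s t = 0 -> D x s t = 0) by (unfold opp3; intros; lra).
  assert (Hpos : forall F Fx1 Fx2 Fs Ft, partials F Fx1 Fx2 Fs Ft -> partials_cont a s0 t0 Fx1 Fx2 Fs Ft ->
            0 < Fs a s0 t0 -> Fs a s0 t0 * Gt a s0 t0 - Gs a s0 t0 * Ft a s0 t0 <> 0 ->
            F a s0 t0 = 0 -> implicit_solution F G a s0 t0).
  { clear F Fx1 Fx2 Fs Ft HF HFc HA Hdet HF0. intros F Fx1 Fx2 Fs Ft HF HFc HA Hdet HF0.
    destruct (Rlt_dec 0 (Fs a s0 t0 * Gt a s0 t0 - Gs a s0 t0 * Ft a s0 t0)).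
    - now apply (implicit_solution_of_continuity F Fx1 Fx2 Fs Ft G Gx1 Gx2 Gs Gt).
    - apply (implicit_solution_zeros F G F (opp3 G)); [now intros | apply Hopp0 |].
      apply (implicit_solution_of_continuity F Fx1 Fx2 Fs Ft
               (opp3 G) (opp3 Gx1) (opp3 Gx2) (opp3 Gs) (opp3 Gt));
        auto using partials_opp, partials_cont_opp; unfold opp3; [lra | rewrite HG0; ring]. }
  destruct (Rlt_dec 0 (Fs a s0 t0)); [now apply (Hpos F Fx1 Fx2 Fs Ft)|].
  apply (implicit_solution_zeros F G (opp3 F) G); [apply Hopp0 | now intros |].
  apply (Hpos (opp3 F) (opp3 Fx1) (opp3 Fx2) (opp3 Fs) (opp3 Ft));
    auto using partials_opp, partials_cont_opp; unfold opp3; [lra | lra | rewrite HF0; ring].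
Qed.

Definition reorder (j : bool) (g : R*R -> R*R -> R) : R*R -> R -> R -> R :=
  fun x s t => g x (mky j s t).
Definition reorder_dx1 (j : bool) (g : R*R -> R*R -> R) : R*R -> R -> R -> R :=
  fun x s t => dx1 g x (mky j s t).
Definition reorder_dx2 (j : bool) (g : R*R -> R*R -> R) : R*R -> R -> R -> R :=
  fun x s t => dx2 g x (mky j s t).
Definition reorder_ds (j : bool) (g : R*R -> R*R -> R) : R*R -> R -> R -> R :=
  fun x s t => (if j then dy1 g else dy2 g) x (mky j s t).
Definition reorder_dt (j : bool) (g : R*R -> R*R -> R) : R*R -> R -> R -> R :=
  fun x s t => (if j then dy2 g else dy1 g) x (mky j s t).

Lemma partials_reorder j g : C1_comp g ->
  partials (reorder j g) (reorder_dx1 j g) (reorder_dx2 j g) (reorder_ds j g) (reorder_dt j g).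
Proof.
  intros [Hd _] x s t. destruct (Hd x (mky j s t)) as [D1 [D2 [D3 D4]]].
  split; [exact (Derive_correct _ _ D1)|]. split; [exact (Derive_correct _ _ D2)|].
  destruct j; split; apply Derive_correct; assumption.
Qed.

Lemma ball_R (x y e : R) : Rabs (y - x) < e -> ball x e y.
Proof. exact (fun H => H). Qed.

Lemma cont_base_of_continuous (h : (R*R)*(R*R) -> R) j a s0 t0 :
  continuous h (a, mky j s0 t0) -> cont_base a s0 t0 (fun x s t => h (x, mky j s t)).
Proof.
  intros Hc eps Heps.
  destruct (proj1 (filterlim_locally h (h (a, mky j s0 t0))) Hc (mkposreal eps Heps)) as [d Hd].
  pose proof (cond_pos d). exists (d / 2). split; [lra|].
  intros x s t [[H1 H2] [H3 H4]]. apply (Hd (x, mky j s t)).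
  destruct j; repeat split; apply ball_R; simpl; lra.
Qed.

Lemma partials_cont_reorder j g a s0 t0 : C1_comp g ->
  partials_cont a s0 t0 (reorder_dx1 j g) (reorder_dx2 j g) (reorder_ds j g) (reorder_dt j g).
Proof.
  intros [_ Hc]. destruct (Hc (a, mky j s0 t0)) as [C1 [C2 [C3 C4]]].
  split; [exact (cont_base_of_continuous _ j a s0 t0 C1)|].
  split; [exact (cont_base_of_continuous _ j a s0 t0 C2)|].
  destruct j; split.
  - exact (cont_base_of_continuous _ true a s0 t0 C3).
  - exact (cont_base_of_continuous _ true a s0 t0 C4).
  - exact (cont_base_of_continuous _ false a s0 t0 C4).
  - exact (cont_base_of_continuous _ false a s0 t0 C3).
Qed.

Definition bj (j : bool) (b : R*R) : R := if j then fst b else snd b.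
Definition bj' (j : bool) (b : R*R) : R := if j then snd b else fst b.

Lemma mky_bj j b : mky j (bj j b) (bj' j b) = b.
Proof. destruct j, b; reflexivity. Qed.

(* [j] is chosen so that [d f_1 / d y_j] does not vanish at [(a, b)]. *)
Lemma implicit_solution_of_cont_diff f a b : cont_diff f -> f a b = (0, 0) -> jac_y_det f a b <> 0 ->
  exists j, implicit_solution (reorder j (f1 f)) (reorder j (f2 f)) a (bj j b) (bj' j b).
Proof.
  intros [C1 C2] Hab Hdet.
  assert (Hj : forall j : bool, (if j then dy1 (f1 f) a b else dy2 (f1 f) a b) <> 0 ->
            implicit_solution (reorder j (f1 f)) (reorder j (f2 f)) a (bj j b) (bj' j b)).
  { intros j Hj.
    apply (implicit_solution_of_nonzero _ (reorder_dx1 j (f1 f)) (reorder_dx2 j (f1 f))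
             (reorder_ds j (f1 f)) (reorder_dt j (f1 f)) _ (reorder_dx1 j (f2 f))
             (reorder_dx2 j (f2 f)) (reorder_ds j (f2 f)) (reorder_dt j (f2 f)));
      try apply partials_reorder; try apply partials_cont_reorder; try assumption;
      unfold reorder_ds, reorder_dt, reorder, f1, f2; rewrite mky_bj, ?Hab; try reflexivity.
    - destruct j; exact Hj.
    - unfold jac_y_det, f1, f2 in Hdet. destruct j; intro E; apply Hdet; lra. }
  destruct (Req_dec (dy1 (f1 f) a b) 0) as [E|E].
  - exists false. apply Hj. intro E2. apply Hdet. unfold jac_y_det. rewrite E, E2. ring.
  - exists true. now apply Hj.
Qed.

Definition proj_square (a : R*R) (r : R) (z : R*R) : R*R :=
  (clamp (fst a - r) (fst a + r) (fst z), clamp (snd a - r) (snd a + r) (snd z)).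

Lemma in_box2_square a r z : in_box2 (fst a - r, snd a - r) (2 * r, 2 * r) z <-> square a r z.
Proof.
  unfold in_box2, in_cint, square; simpl. rewrite !Rabs_le_between'.
  split; intros [H1 H2]; split; lra.
Qed.

(* Clamping onto the square extends [S] without increasing its Lipschitz constant. *)
Lemma lip2_extension a r S L : 0 < r -> 0 <= L -> lip2_on (square a r) S L ->
  exists H, lip2 H L /\ forall z, in_box2 (fst a - r, snd a - r) (2 * r, 2 * r) z -> S z = H z.
Proof.
  intros Hr HL HS. exists (fun z => S (proj_square a r z)). split.
  - split; [exact HL|]. intros z z'.
    assert (Hin : forall w, square a r (proj_square a r w)).
    { intro w. unfold proj_square, square; simpl. rewrite !Rabs_le_between'.
      pose proof (clamp_in (fst a - r) (fst a + r) (fst w)).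
      pose proof (clamp_in (snd a - r) (snd a + r) (snd w)). split; lra. }
    eapply Rle_trans; [apply HS; apply Hin|].
    apply Rmult_le_compat_l; [exact HL|]. unfold l1_dist, proj_square; simpl.
    apply Rplus_le_compat; apply clamp_lip; lra.
  - intros z Hz. apply in_box2_square in Hz. destruct Hz as [H1 H2].
    apply Rabs_le_between' in H1, H2. unfold proj_square. rewrite !clamp_id by lra.
    now destruct z.
Qed.

Theorem theorem2 (f : R*R -> R*R -> R*R) (a b : R*R) :
  cont_diff f -> f a b = (0, 0) -> jac_y_det f a b <> 0 ->
  exists (rl rs : R*R) (v1l v1s v2l v2s : R) (j : bool)
         (p : R*R -> R -> R) (q : R*R -> R),
    let Vjl := if j then v1l else v2l in
    let Vjs := if j then v1s else v2s in
    let Vj'l := if j then v2l else v1l in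
    let Vj's := if j then v2s else v1s in
    0 < fst rs /\ 0 < snd rs /\ 0 < v1s /\ 0 < v2s /\
    in_box2 rl rs a /\ in_cint v1l v1s (fst b) /\ in_cint v2l v2s (snd b) /\
    (forall x t, in_box2 rl rs x -> in_cint Vj'l Vj's t -> in_cint Vjl Vjs (p x t)) /\
    (forall x, in_box2 rl rs x -> in_cint Vj'l Vj's (q x)) /\
    (forall x, in_box2 rl rs x -> f x (mky j (p x (q x)) (q x)) = (0, 0)) /\
    cont_on_box3 rl rs Vj'l Vj's p /\ cont_on_box2 rl rs q /\
    Pn_limit3 rl rs Vj'l Vj's a (if j then snd b else fst b) p /\
    Pn_limit2 rl rs a q.
Proof.
  intros Hf Hab Hdet.
  destruct (implicit_solution_of_cont_diff f a b Hf Hab Hdet)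
    as [j [r [d [L [S [Q [Hr [Hd [HL [HSQ [HS HQ]]]]]]]]]]].
  destruct (lip2_extension a r S L Hr HL HS) as [SL [HSL ES]].
  destruct (lip2_extension a r Q L Hr HL HQ) as [QL [HQL EQ]].
  assert (Hsq : forall x, in_box2 (fst a - r, snd a - r) (2 * r, 2 * r) x -> square a r x)
    by (intro; apply in_box2_square).
  assert (Hcint : forall c u, Rabs (u - c) <= d -> in_cint (c - d) (2 * d) u)
    by (intros c u Hu; apply Rabs_le_between' in Hu; unfold in_cint; lra).
  exists (fst a - r, snd a - r), (2 * r, 2 * r), (fst b - d), (2 * d), (snd b - d), (2 * d), j,
    (fun x _ => S x), Q.
  cbv zeta. replace (if j then 2 * d else 2 * d) with (2 * d) by (now destruct j).
  replace (if j then fst b - d else snd b - d) with (bj j b - d) by (now destruct j).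
  replace (if j then snd b - d else fst b - d) with (bj' j b - d) by (now destruct j).
  repeat match goal with |- _ /\ _ => split end; simpl; try lra.
  - apply in_box2_square. split; rewrite Rminus_diag, Rabs_R0; lra.
  - apply Hcint. rewrite Rminus_diag, Rabs_R0; lra.
  - apply Hcint. rewrite Rminus_diag, Rabs_R0; lra.
  - intros x t Hx _. apply Hcint, HSQ, Hsq, Hx.
  - intros x Hx. apply Hcint, HSQ, Hsq, Hx.
  - intros x Hx. destruct (HSQ x (Hsq x Hx)) as [_ [_ [E1 E2]]]. unfold reorder, f1, f2 in E1, E2.
    rewrite (surjective_pairing (f x _)). exact (f_equal2 pair E1 E2).
  - exact (cont_on_box3_of_lip2 _ _ _ _ S SL L HSL ES).
  - exact (cont_on_box2_of_lip2 _ _ Q QL L HQL EQ).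
  - apply (Pn_limit3_of_lip2 _ _ _ _ _ _ S SL L); simpl; auto; lra.
  - apply (Pn_limit2_of_lip2 _ _ _ Q QL L); simpl; auto; lra.
Qed.
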